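(* Suppose that there exists $\kappa>0$ such that for all $i\in\{0,\dots,n-1\}$, $X_i$ admits a density $\varphi_i$ with respect to the Lebesgue measure $\mu$ such that $\varphi_i(x)\le\kappa$ for all $x\in[0,1]^d$. Then for all $p\in(2d/(d+1),+\infty)$, all $\sigma\in(2d(1/p-1/2)_+,1)$, and whenever the restriction $\sqrt{s}|_A$ of $\sqrt s$ to $A$ belongs to $\mathscr{B}^\sigma(\mathbb{L}^p([0,1]^{2d}))$, the estimator $\hat s=\hat s(L_0,\infty)$ satisfies $$C'\,\mathbb{E}\left[H^2(s\mathbf{1}_A,\hat s)\right]\le\left|\sqrt{s}|_A\right|_{p,\sigma}^{\frac{2d}{d+\sigma}}\left(\frac{\log n}{n}\right)^{\frac{\sigma}{\sigma+d}}+\frac{\log n}{n},$$ where $C'>0$ depends only on $\kappa,\sigma,d,p$.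
   Context: Setting. Let $d\ge 1$ and $n>3$ be integers, $\mathbb{N}^\star=\{1,2,\dots\}$, $x_+=\max(x,0)$. $(X_i)_{i\ge 0}$ is a time-homogeneous Markov chain with values in $\mathbb{X}=\mathbb{R}^d$, endowed with the Lebesgue measure $\mu$. For each $x$, the conditional law of $X_{i+1}$ given $X_i=x$ has a density $s(x,\cdot)$ with respect to $\mu$. The transition density $s$ is to be estimated on $A=[0,1]^{2d}$ from $X_0,\dots,X_n$. ''Universal'' means not depending on any other quantity. Besov spaces. $\mathscr{B}^\sigma_q(\mathbb{L}^p([0,1]^{2d}))$ is the usual (isotropic) Besov space defined through moduli of smoothness (as in DeVore and Yu, 1990): for $\sigma\in(0,1)$, with $\omega(f,t)_p=\sup_{|u|\le t}\|f(\cdot+u)-f(\cdot)\|_{\mathbb{L}^p}$ (norm over the $x$ with $x,x+u\in[0,1]^{2d}$), its semi-norm is $(\int_0^\infty(t^{-\sigma}\omega(f,t)_p)^q\,dt/t)^{1/q}$ if $q<\infty$ and $\sup_{t>0}t^{-\sigma}\omega(f,t)_p$ if $q=\infty$. For $\sigma\in(0,1)$, $\mathscr{B}^\sigma(\mathbb{L}^p([0,1]^{2d}))$ stands for $\mathscr{B}^\sigma_p(\mathbb{L}^p([0,1]^{2d}))$ if $p\in(1,2)$ and for $\mathscr{B}^\sigma_\infty(\mathbb{L}^p([0,1]^{2d}))$ if $p\in[2,\infty)$; $|\cdot|_{p,\sigma}$ is its semi-norm. Loss. For $f,f'$ non-negative and integrable with respect to $M=\lambda_n\otimes\mu$, $\lambda_n=n^{-1}\sum_{i=0}^{n-1}\delta_{X_i}$,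 $$H^2(f,f')=\frac1{2n}\sum_{i=0}^{n-1}\int_{\mathbb{X}}\left(\sqrt{f(X_i,y)}-\sqrt{f'(X_i,y)}\right)^2 d\mu(y),$$ and $H(f,V)=\inf_{g\in V}H(f,g)$. Partitions. For $j\in\mathbb{N}$, $\mathcal{K}_j$ is the set of the $2^{2dj}$ dyadic cubes $\prod_{i=1}^{2d}I_j(l_i)$, $1\le l_i\le 2^j$, where $I_j(l)=[(l-1)2^{-j},l2^{-j})$ if $l<2^j$ and $I_j(2^j)=[(2^j-1)2^{-j},1]$. Start from the partition $\{[0,1]^{2d}\}$; at each step, for each cube of the current partition (belonging to some $\mathcal{K}_j$) one decides to divide it into the $4^d$ elements of $\mathcal{K}_{j+1}$ contained in it, or not. $\mathcal{M}_\ell$ is the set of partitions obtained in at most $\ell$ steps, and $\mathcal{M}_\infty=\bigcup_{\ell\ge1}\mathcal{M}_\ell$. For a partition $m$, $V_m=\{\sum_{K\in m}a_K\mathbf{1}_K:\ a_K\in[0,\infty)\}$, and $$\hat s_m=\sum_{K\in m}\frac{\sum_{i=0}^{n-1}\mathbf{1}_K(X_i,X_{i+1})}{\sum_{i=0}^{n-1}\int\mathbf{1}_K(X_i,x)\,d\mu(x)}\mathbf{1}_K,$$ with $0/0=0$. Selection rule ($\ell\in\mathbb{N}^\star\cup\{\infty\}$). For $K\in\bigcup_{m\in\mathcal{M}_\ell}m$ and $m'\in\mathcal{M}_\ell$, let $m'\vee K=\{K'\cap K:\ K'\in m',\ K\cap K'\neq\emptyset\}$. For $L>0$ put $\mathrm{pen}(m'\vee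 K)=L|m'\vee K|\log n/n$ (so $\mathrm{pen}(m)=L|m|\log n/n$). Let $\alpha=(1-1/\sqrt2)/2$ and, with $0/0=0$, $$T(f,f')=\frac1{2n\sqrt2}\sum_{i=0}^{n-1}\int_{\mathbb{X}}\sqrt{f(X_i,y)+f'(X_i,y)}\left(\sqrt{f'(X_i,y)}-\sqrt{f(X_i,y)}\right)d\mu(y)$$ $$+\frac1{n\sqrt2}\sum_{i=0}^{n-1}\frac{\sqrt{f'(X_i,X_{i+1})}-\sqrt{f(X_i,X_{i+1})}}{\sqrt{f(X_i,X_{i+1})+f'(X_i,X_{i+1})}}+\frac1{2n}\sum_{i=0}^{n-1}\int_{\mathbb{X}}(f(X_i,y)-f'(X_i,y))\,d\mu(y).$$ For $m\in\mathcal{M}_\ell$ let $$\gamma(m)=\sum_{K\in m}\sup_{m'\in\mathcal{M}_\ell}\left[\sum_{K'\in m'}\left(\alpha H^2(\hat s_m\mathbf{1}_{K\cap K'},\hat s_{m'}\mathbf{1}_{K\cap K'})+T(\hat s_m\mathbf{1}_{K\cap K'},\hat s_{m'}\mathbf{1}_{K\cap K'})\right)-\mathrm{pen}(m'\vee K)\right]+2\,\mathrm{pen}(m).$$ $\hat m$ is any element of $\mathcal{M}_\ell$ with $\gamma(\hat m)\le\inf_{m\in\mathcal{M}_\ell}\gamma(m)+1/n$, and $\hat s(L,\ell)=\hat s_{\hat m}$. The constant $L_0$. $L_0>0$ is a universal constant such that, for some universal $C_0>0$, for all such chains and all $L\ge L_0$, $\ell\in\mathbb{N}^\star\cup\{\infty\}$: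 $C_0\mathbb{E}[H^2(s\mathbf{1}_A,\hat s(L,\ell))]\le\inf_{m\in\mathcal{M}_\ell}\{\mathbb{E}[H^2(s\mathbf{1}_A,V_m)]+\mathrm{pen}(m)\}$. *)

(* Defs.v *)
From HB Require Import structures.
From mathcomp Require Import all_boot all_order all_algebra finmap.
From mathcomp Require Import all_classical all_reals all_analysis.

Set Implicit Arguments.
Unset Strict Implicit.
Unset Printing Implicit Defensive.
Import Order.TTheory GRing.Theory Num.Theory.
Import numFieldNormedType.Exports.

Local Open Scope classical_set_scope.
Local Open Scope ring_scope.

(* R^d, with the library's sigma-algebra on tuples (generated by the
   coordinates, i.e. the Borel sets). *)
Notation Rd R d := (d.-tuple (measurableTypeR R)).

(* One step of the construction of the Lebesgue measure on R^d: from a measure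
   [m] on R^d, the product of the Lebesgue measure on R by [m], carried over
   to R^(d+1). *)
Section lebesgue_succ.
Context {R : realType} {d : nat}.
Variable m : {sigma_finite_measure set (Rd R d) -> \bar R}.

Definition cons_Rd (z : measurableTypeR R * Rd R d) : Rd R d.+1 :=
  [tuple of z.1 :: z.2].

Let measurable_cons_Rd : measurable_fun setT cons_Rd.
Proof. exact: measurable_cons. Qed.

HB.instance Definition _ :=
  isMeasurableFun.Build _ _ _ _ cons_Rd measurable_cons_Rd.

Definition lebesgue_succ : set (Rd R d.+1) -> \bar R :=
  pushforward (@lebesgue_measure R \x m)%E cons_Rd.

Let lebesgue_succ0 : lebesgue_succ set0 = 0%E.
Proof. exact: measure0. Qed.

Let lebesgue_succ_ge0 A : (0 <= lebesgue_succ A)%E.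
Proof. exact: measure_ge0. Qed.

Let lebesgue_succ_sigma_additive : semi_sigma_additive lebesgue_succ.
Proof. exact: measure_semi_sigma_additive. Qed.

HB.instance Definition _ := isMeasure.Build _ _ _ lebesgue_succ
  lebesgue_succ0 lebesgue_succ_ge0 lebesgue_succ_sigma_additive.

Let lebesgue_succ_sigma_finite : sigma_finite setT lebesgue_succ.
Proof.
have /sigma_finiteP[F [TF ndF Foo]] := sigma_finiteT (@lebesgue_measure R).
have /sigma_finiteP[G [TG ndG Goo]] := sigma_finiteT m.
exists (fun n => [set x : Rd R d.+1 |
    F n (thead x) /\ G n [tuple of behead x]]).
  apply/seteqP; split=> // x _.
  have [i _ Fi] : (\bigcup_n F n) (thead x) by rewrite -TF.
  have [j _ Gj] : (\bigcup_n G n) [tuple of behead x] by rewrite -TG.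
  exists (maxn i j) => //=; split.
    by move: Fi; exact/subsetPset/ndF/leq_maxl.
  by move: Gj; exact/subsetPset/ndG/leq_maxr.
move=> n; have [mF Fn] := Foo n; have [mG Gn] := Goo n; split.
  apply: measurableI; rewrite -[X in measurable X]setTI.
    exact: measurable_tnth.
  exact: measurable_behead.
rewrite /lebesgue_succ /pushforward.
rewrite (_ : _ @^-1` _ = F n `*` G n); last first.
  apply/seteqP; split=> -[a t] /= [Fa Gt]; split => //.
    by move: Gt; congr (G n _); exact: val_inj.
  by move: Gt; congr (G n _); exact: val_inj.
by rewrite product_measure1E// lte_mul_pinfty// ge0_fin_numE.
Qed.

HB.instance Definition _ := Measure_isSigmaFinite.Build _ _ _ lebesgue_succ
  lebesgue_succ_sigma_finite.

End lebesgue_succ.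

Fixpoint lebesgue_Rd (R : realType) (d : nat) :
    {sigma_finite_measure set (Rd R d) -> \bar R} :=
  if d is d'.+1 then lebesgue_succ (lebesgue_Rd R d')
  else dirac ([tuple] : Rd R 0).

(* R^(2d) is represented by R^d * R^d. *)
Notation Rdd R d := (Rd R d * Rd R d)%type.

Section dyadic_partitions.
Context {R : realType} {d : nat}.

Definition unit_cube : set (Rd R d) := [set x | forall k, 0 <= tnth x k <= 1].

Definition unit_cube2 : set (Rdd R d) := unit_cube `*` unit_cube.

Definition dyadic_side (j l : nat) : set R :=
  if (l < 2 ^ j)%N then `[(l%:R - 1) / 2 ^+ j, l%:R / 2 ^+ j[%classic
  else `[(2 ^+ j - 1) / 2 ^+ j, 1]%classic.

(* In the product R^d * R^d, [l] indexes the sides along the first d axes and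
   [l'] those along the last d ones. *)
Definition dyadic_cubes (j : nat) : set (set (Rdd R d)) :=
  [set K | exists l l' : 'I_d -> nat,
    [/\ forall k, (1 <= l k <= 2 ^ j)%N,
        forall k, (1 <= l' k <= 2 ^ j)%N &
        K = [set z | forall k, dyadic_side j (l k) (tnth z.1 k) /\
                               dyadic_side j (l' k) (tnth z.2 k)]]].

Definition dyadic_child (K K' : set (Rdd R d)) : Prop :=
  exists j, [/\ dyadic_cubes j K, dyadic_cubes j.+1 K' & K' `<=` K].

(* [D] is the set of cubes of [m] that are divided. *)
Definition refinement_step (m m' : {fset set (Rdd R d)}) : Prop :=
  exists D : {fset set (Rdd R d)}, (D `<=` m)%fset /\
    forall K', K' \in m' <->
      (K' \in m /\ K' \notin D) \/ (exists2 K, K \in D & dyadic_child K K').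

Inductive partition_after : nat -> {fset set (Rdd R d)} -> Prop :=
| partition_after0 : partition_after 0 [fset unit_cube2]%fset
| partition_afterS k m m' : partition_after k m -> refinement_step m m' ->
    partition_after k.+1 m'.

Definition partitions_le (l : nat) : set {fset set (Rdd R d)} :=
  [set m | exists2 k, (k <= l)%N & partition_after k m].

(* [None] stands for l = oo. *)
Definition partitions (l : option nat) : set {fset set (Rdd R d)} :=
  if l is Some l' then partitions_le l'
  else \bigcup_(l' in [set l' | (1 <= l')%N]) partitions_le l'.

Definition join_cube (m : {fset set (Rdd R d)}) (K : set (Rdd R d)) :
    {fset set (Rdd R d)} :=
  [fset (K' `&` K)%classic | K' in m & (K `&` K')%classic != set0]%fset.

Definition step_functions (m : {fset set (Rdd R d)}) : set (Rdd R d -> R) :=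
  [set g | exists2 a : set (Rdd R d) -> R, (forall K, 0 <= a K) &
    g = fun z => \sum_(K <- m) a K * \1_K z].

End dyadic_partitions.

(* Below, [x : nat -> R^d] is a realization of the chain, of which only
   [x 0, ..., x n] are used. *)
Section estimator.
Context {R : realType} {d : nat}.
Implicit Types (n : nat) (x : nat -> Rd R d) (f g : Rdd R d -> R)
  (m : {fset set (Rdd R d)}) (K : set (Rdd R d)).

Definition times_indic f K : Rdd R d -> R := fun z => f z * \1_K z.

Definition hellinger2 n x f g : R :=
  (2 * n%:R)^-1 * \sum_(i < n)
    \int[lebesgue_Rd R d]_y (Num.sqrt (f (x i, y)) - Num.sqrt (g (x i, y))) ^+ 2.

Definition hellinger n x f g : R := Num.sqrt (hellinger2 n x f g).

Definition hellinger_set n x f (V : set (Rdd R d -> R)) : R :=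
  inf [set hellinger n x f g | g in V].

Definition histogram n x m : Rdd R d -> R := fun z =>
  \sum_(K <- m)
    (\sum_(i < n) \1_K (x i, x i.+1)) /
    (\sum_(i < n) \int[lebesgue_Rd R d]_y (\1_K (x i, y) : R)) * \1_K z.

Definition penalty n (L : R) m : R := L * #|` m|%:R * ln n%:R / n%:R.

Definition alpha : R := (1 - (Num.sqrt 2)^-1) / 2.

Definition test_T n x f g : R :=
  (2 * n%:R * Num.sqrt 2)^-1 * (\sum_(i < n) \int[lebesgue_Rd R d]_y
    (Num.sqrt (f (x i, y) + g (x i, y)) *
     (Num.sqrt (g (x i, y)) - Num.sqrt (f (x i, y))))) +
  (n%:R * Num.sqrt 2)^-1 * (\sum_(i < n)
    (Num.sqrt (g (x i, x i.+1)) - Num.sqrt (f (x i, x i.+1))) /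
    Num.sqrt (f (x i, x i.+1) + g (x i, x i.+1))) +
  (2 * n%:R)^-1 * (\sum_(i < n) \int[lebesgue_Rd R d]_y
    (f (x i, y) - g (x i, y))).

Definition crit_gamma n (L : R) (l : option nat) x m : \bar R :=
  (\sum_(K <- m) ereal_sup [set
     (\sum_(K' <- m')
        (let f := times_indic (histogram n x m) (K `&` K') in
         let g := times_indic (histogram n x m') (K `&` K') in
         alpha * hellinger2 n x f g + test_T n x f g)
      - penalty n L (join_cube m' K))%:E | m' in partitions l]
   + (2 * penalty n L m)%:E)%E.

Definition near_minimizer n (L : R) (l : option nat) x m : Prop :=
  partitions l m /\
  (crit_gamma n L l x m <=
   ereal_inf [set crit_gamma n L l x m' | m' in partitions l] + (n%:R^-1)%:E)%E.

End estimator.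

Section markov_chains.
Context {R : realType} {d : nat} {disp : measure_display}.
Context {Omega : measurableType disp}.
Implicit Types (P : probability Omega R) (X : nat -> {mfun Omega >-> Rd R d})
  (s : Rdd R d -> R).

Definition past X (i : nat) : set (set Omega) :=
  <<s [set E | exists (j : nat) (B : set (Rd R d)),
         [/\ (j <= i)%N, measurable B & E = X j @^-1` B]] >>.

Definition transition_density s : Prop :=
  [/\ measurable_fun setT s, forall z, 0 <= s z &
      forall x, (\int[lebesgue_Rd R d]_y (s (x, y))%:E = 1)%E].

Definition markov_chain P X s : Prop :=
  transition_density s /\
  forall (i : nat) (E : set Omega) (B : set (Rd R d)),
    past X i E -> measurable B ->
    (P (E `&` X i.+1 @^-1` B) =
     \int[P]_(w in E) \int[lebesgue_Rd R d]_(y in B) (s (X i w, y))%:E)%E.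

Definition has_density P (Y : {mfun Omega >-> Rd R d}) (phi : Rd R d -> R) :
    Prop :=
  [/\ measurable_fun setT phi, forall x, 0 <= phi x &
      forall B : set (Rd R d), measurable B ->
        distribution P Y B = (\int[lebesgue_Rd R d]_(x in B) (phi x)%:E)%E].

(* An estimator is a random variable, hence the measurability of the selected
   partition (there are only countably many partitions). *)
Definition selected n (L : R) (l : option nat) X
    (mhat : Omega -> {fset set (Rdd R d)}) : Prop :=
  (forall m, measurable (mhat @^-1` [set m])) /\
  forall w, near_minimizer n L l (X^~ w) (mhat w).

Definition risk P n X s (mhat : Omega -> {fset set (Rdd R d)}) : \bar R :=
  'E_P[fun w => hellinger2 n (X^~ w) (times_indic s unit_cube2)
                  (histogram n (X^~ w) (mhat w))].

Definition oracle_bound P n (L : R) (l : option nat) X s : \bar R :=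
  ereal_inf [set ('E_P[fun w => (hellinger_set n (X^~ w)
                     (times_indic s unit_cube2) (step_functions m) ^+ 2)%R] +
                  (penalty n L m)%:E)%E | m in partitions l].

End markov_chains.

(* [C0] is chosen before the dimension, the sample size and the chain. *)
Definition oracle_constant (R : realType) (L0 : R) : Prop :=
  0 < L0 /\
  exists2 C0 : R, 0 < C0 &
  forall (d n : nat), (1 <= d)%N -> (3 < n)%N ->
  forall (disp : measure_display) (Omega : measurableType disp)
    (P : probability Omega R) (X : nat -> {mfun Omega >-> Rd R d})
    (s : Rdd R d -> R), markov_chain P X s ->
  forall (L : R) (l : option nat), L0 <= L -> l <> Some 0%N ->
  forall mhat : Omega -> {fset set (Rdd R d)}, selected n L l X mhat ->
    (C0%:E * risk P n X s mhat <= oracle_bound P n L l X s)%E.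

(* Besov spaces on [0,1]^(2d); functions are defined on R^(2d), but only their
   values on [0,1]^(2d) matter. *)
Section besov.
Context {R : realType} {d : nat}.
Implicit Types (u z : Rdd R d) (f : Rdd R d -> R) (p sigma : R).

Definition translate z u : Rdd R d :=
  ([tuple tnth z.1 k + tnth u.1 k | k < d],
   [tuple tnth z.2 k + tnth u.2 k | k < d]).

Definition euclidean_norm u : R :=
  Num.sqrt (\sum_(k < d) (tnth u.1 k ^+ 2 + tnth u.2 k ^+ 2)).

Definition Lp_norm p f (D : set (Rdd R d)) : \bar R :=
  'N[(lebesgue_Rd R d \x lebesgue_Rd R d)%E]_(p%:E)[(EFin \o f) \_ D]%E.

Definition modulus p f (t : R) : \bar R :=
  ereal_sup [set Lp_norm p (fun z => f (translate z u) - f z)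
                   [set z | unit_cube2 z /\ unit_cube2 (translate z u)]
            | u in [set u | euclidean_norm u <= t]].

Definition besov_seminorm sigma (q : \bar R) p f : \bar R :=
  if q is q'%:E then
    ((\int[lebesgue_measure]_(t in `]0%R, +oo[%classic)
        (((t `^ (- sigma))%:E * modulus p f t) `^ q' * (t^-1)%:E)) `^ q'^-1)%E
  else ereal_sup [set ((t `^ (- sigma))%:E * modulus p f t)%E
                 | t in `]0%R, +oo[%classic].

Definition in_besov sigma (q : \bar R) p f : Prop :=
  [/\ measurable_fun unit_cube2 f, (Lp_norm p f unit_cube2 < +oo)%E &
      (besov_seminorm sigma q p f < +oo)%E].

(* The second index of B^sigma(L^p): p if 1 < p < 2, infinity if p >= 2. *)
Definition besov_q p : \bar R := if p < 2 then p%:E else +oo%E.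

End besov.

(* Main.v *)
(* By the oracle inequality it suffices to find, for f = sqrt s and
   eta = log n / n, a partition m of the family and a step function g on m with
   |m| <= C (1 + N) and |f - g|_2^2 <= C eta (1 + N), where
   N = (|f|_{p,sigma}^2 / eta)^(d/(d+sigma)).  Indeed the bound kappa on the
   densities of the X_i turns E[H^2(s 1_A, g^2)] into at most
   (kappa/2) |f - g|_2^2.

   If p >= 2, a regular partition does.  If p < 2, let a(K) be the integral over
   K x K of |f(x) - f(y)|^p times the kernel
   sum_i 2^(i (2d + sigma p)) 1(|x - y| <= 2^-i): it is superadditive in K, and
   a(A) <= C |f|_{p,sigma}^p by translation invariance.  A Poincare inequality
   bounds the squared L^2 distance on K from f to a constant by
   C r^j a(K)^(2/p) for a cube K of level j, with r < 1 because
   sigma > 2d (1/p - 1/2).  Dividing the cubes for which r^j a(K)^(2/p) > eta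
   leaves an error of order eta on each piece; superadditivity bounds the number
   of divided cubes of each level, and the sum over the levels is geometric on
   both sides of the level at which 2^(2dj) is about N. *)

Require Import Defs.
From HB Require Import structures.
From mathcomp Require Import all_boot all_order all_algebra finmap.
From mathcomp Require Import all_classical all_reals all_analysis.
From mathcomp Require Import measurable_realfun.
From mathcomp Require Import ring lra zify.

Set Implicit Arguments.
Unset Strict Implicit.
Unset Printing Implicit Defensive.
Import Order.TTheory GRing.Theory Num.Theory.
Import numFieldNormedType.Exports.

Local Open Scope classical_set_scope.
Local Open Scope ring_scope.

(** * Measure-theoretic preliminaries *)

(** Smoothness is handled through double integrals of |f(x) - f(y)|^p over K x K rather than through
    distances to constants. Translation invariance turns a modulus of smoothness into such an
    integral. It is superadditive in K, and it is monotone under truncation of f, whereas good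
    constants change with the truncation level. Constants come back by averaging: when the double
    integral over K x K is small, some value f(y) with y in K is a good constant. It is
    automatically non-negative and is found without assuming f integrable.

    The kernel sums over all scales so that one function serves every level. The energy at scale
    2^-j alone would control the cubes of level j, but energies taken at different scales would not
    be superadditive from a cube to its children.

    With S a bound on the semi-norm and N defined from S, N solves eta N = S^2 N^(-sigma/d): the
    penalty of N pieces balances the squared error on N equal cubes. The 1 in 1 + N allows for the
    undivided cube and produces the separate term log n / n. *)

Section product_measure.
Context {R : realType} {d1 d2 : measure_display}.
Context {T1 : measurableType d1} {T2 : measurableType d2}.
Variable m1 : {sigma_finite_measure set T1 -> \bar R}.
Variable m2 : {sigma_finite_measure set T2 -> \bar R}.

(* The library makes [m1 \x m2] canonically sigma-finite only for
   subprobabilities; this copy is convertible to it. *)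
Definition sprod : set (T1 * T2)%type -> \bar R := (m1 \x m2)%E.

HB.instance Definition _ := Measure.on sprod.

Let sprod_sigma_finite : sigma_finite setT sprod.
Proof.
have /sigma_finiteP[F [TF ndF Foo]] := sigma_finiteT m1.
have /sigma_finiteP[G [TG ndG Goo]] := sigma_finiteT m2.
exists (fun n => F n `*` G n).
  apply/seteqP; split=> // -[x y] _.
  have [i _ Fi] : (\bigcup_n F n) x by rewrite -TF.
  have [j _ Gj] : (\bigcup_n G n) y by rewrite -TG.
  exists (maxn i j) => //=; split.
    by move: Fi; exact/subsetPset/ndF/leq_maxl.
  by move: Gj; exact/subsetPset/ndG/leq_maxr.
move=> k; have [? ?] := Foo k; have [? ?] := Goo k.
split; first exact: measurableX.
by rewrite /sprod product_measure1E// lte_mul_pinfty// ge0_fin_numE.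
Qed.

HB.instance Definition _ := Measure_isSigmaFinite.Build _ _ _ sprod
  sprod_sigma_finite.

End product_measure.

Lemma measurable_fun_sqrt {R : realType} {disp : measure_display}
    {T : measurableType disp} (u : T -> R) :
  measurable_fun setT u -> measurable_fun setT (fun z => Num.sqrt (u z)).
Proof.
move=> mu; apply: (measurableT_comp _ mu).
by apply: continuous_measurable_fun; exact: sqrt_continuous.
Qed.

Section integral_extra.
Context {R : realType} {disp : measure_display} {T : measurableType disp}.
Variable mu : {measure set T -> \bar R}.
Local Open Scope ereal_scope.

(* Unlike [ge0_le_integral], this does not ask for measurability. *)
Lemma ge0_le_integral_nomeas (D : set T) (f g : T -> \bar R) :
  (forall x, D x -> 0 <= f x) -> (forall x, D x -> f x <= g x) ->
  \int[mu]_(x in D) f x <= \int[mu]_(x in D) g x.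
Proof.
move=> f0 fg; have g0 x : D x -> 0 <= g x.
  by move=> Dx; apply: le_trans (fg _ Dx); exact: f0.
rewrite !ge0_integralE//; apply: le_ereal_sup => _ [h /= hf <-].
exists h => // x; apply: le_trans (hf x) _.
by rewrite !patchE; case: ifPn => // xD; apply: fg; rewrite inE in xD.
Qed.

(** Otherwise [h - b] would be positive on [K] with integral zero, hence zero almost everywhere,
    although [K] has positive measure. This is the averaging argument that selects a value of the
    function as the constant on a cube. *)
Lemma exists_le_mean (K : set T) (h : T -> \bar R) (b : R) :
  measurable K -> 0 < mu K -> mu K < +oo ->
  measurable_fun K h -> (forall x, K x -> 0 <= h x) -> (0 <= b)%R ->
  \int[mu]_(x in K) h x <= b%:E * mu K ->
  exists2 x, K x & h x <= b%:E.
Proof.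
move=> mK K0 Koo mh h0 b0 hb; apply: contrapT => /forall2NP nex.
have hgt x : K x -> b%:E < h x.
  by move=> Kx; case: (nex x) => [//|/negP]; rewrite -ltNge.
have mhb : measurable_fun K (fun x => h x - b%:E) by exact: emeasurable_funB.
have hb0 x : K x -> 0 <= h x - b%:E.
  by move=> Kx; rewrite leeBrDr ?fin_num_fine// add0e ltW// hgt.
have int0 : \int[mu]_(x in K) (h x - b%:E) = 0.
  apply/eqP; rewrite eq_le integral_ge0// andbT.
  have cfin : b%:E * mu K \is a fin_num.
    by rewrite fin_numM// ge0_fin_numE// ltW.
  rewrite -(@leeD2rE _ (b%:E * mu K))// add0e; apply: le_trans hb.
  rewrite -(integral_cst mu mK) -ge0_integralD//.
  apply: ge0_le_integral_nomeas => x Kx; last by rewrite subeK.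
  by rewrite adde_ge0// hb0.
have /ae_eq_integral_abs : \int[mu]_(x in K) `|h x - b%:E| = 0.
  by rewrite -int0; apply: eq_integral => x /[!inE] Kx; rewrite gee0_abs// hb0.
move=> /(_ mK mhb) [N [mN N0 subN]].
suff : mu K <= mu N by rewrite N0 leNgt K0.
apply: le_measure; rewrite ?inE// => x Kx; apply: subN => /= /(_ Kx).
move=> hx; have := hgt x Kx.
by rewrite -(@subeK _ (h x) b%:E)// hx add0e ltxx.
Qed.

End integral_extra.

Section integral_families.
Context {R : realType} {disp : measure_display} {T : measurableType disp}.
Variable mu : {measure set T -> \bar R}.
Local Open Scope ereal_scope.

Let integral_split (A D : set T) (f : T -> \bar R) : measurable A ->
  measurable D -> measurable_fun D f -> (forall x, D x -> 0 <= f x) ->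
  \int[mu]_(x in D) f x =
  \int[mu]_(x in D `&` A) f x + \int[mu]_(x in D `\` A) f x.
Proof.
move=> mA mD mf f0; rewrite -ge0_integral_setU ?setUIDK//.
- exact: measurableI.
- exact: measurableD.
- by apply/disj_setPS => x [[_ Ax] [_ /(_ Ax)]].
Qed.

Lemma sum_integral_disjoint_le (I : eqType) (s : seq I) (F : I -> set T)
    (D : set T) (f : T -> \bar R) :
  measurable D -> measurable_fun D f -> (forall x, D x -> 0 <= f x) ->
  uniq s -> (forall i, i \in s -> measurable (F i)) ->
  (forall i, i \in s -> F i `<=` D) ->
  (forall i j x, i \in s -> j \in s -> F i x -> F j x -> i = j) ->
  \sum_(i <- s) \int[mu]_(x in F i) f x <= \int[mu]_(x in D) f x.
Proof.
elim: s D => [|i s IH] D mD mf f0 /=.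
  by move=> *; rewrite big_nil integral_ge0.
move=> /andP[si us] mF FD FF; have si' := mem_head i s.
have sub j : j \in s -> j \in i :: s by rewrite inE orbC => ->.
rewrite big_cons (integral_split (mF _ si') mD mf f0).
rewrite (setIidr (FD _ si')) leeD2l//; apply: IH => //.
- by apply: measurableD => //; exact: mF.
- exact: measurable_funS mf.
- by move=> x [/f0].
- by move=> j js; apply: mF; exact: sub.
- move=> j js x Fj; split; first exact: FD (sub _ js) _ Fj.
  by move=> Fi; move: si; rewrite (FF i j x)// ?js// sub.
- by move=> j k x js ks; apply: FF; exact: sub.
Qed.

Lemma integral_le_sum_cover (I : eqType) (s : seq I) (F : I -> set T)
    (D : set T) (f : T -> \bar R) :
  measurable D -> measurable_fun setT f -> (forall x, 0 <= f x) ->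
  (forall i, i \in s -> measurable (F i)) ->
  (forall x, D x -> exists2 i, i \in s & F i x) ->
  \int[mu]_(x in D) f x <= \sum_(i <- s) \int[mu]_(x in F i) f x.
Proof.
move=> + mf f0; elim: s D => [|i s IH] D mD mF cov.
  rewrite big_nil (_ : D = set0) ?integral_set0//.
  by apply/seteqP; split=> // x /cov[].
have si' := mem_head i s; have mFi := mF _ si'.
rewrite big_cons (integral_split mFi mD)//; last exact: measurable_funTS.
apply: leeD.
  apply: ge0_subset_integral => //; first exact: measurableI.
  exact: measurable_funTS.
apply: IH; first exact: measurableD.
  by move=> j js; apply: mF; rewrite inE js orbT.
move=> x [Dx nFi]; have [j] := cov x Dx; rewrite inE => /orP[/eqP ->//|js Fj].
by exists j.
Qed.

End integral_families.

Section integral_rectangle.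
Context {R : realType} {d1 d2 : measure_display}.
Context {T1 : measurableType d1} {T2 : measurableType d2}.
Variable m1 : {sigma_finite_measure set T1 -> \bar R}.
Variable m2 : {sigma_finite_measure set T2 -> \bar R}.
Local Open Scope ereal_scope.

Lemma integral_rectangle (A : set T1) (B : set T2) (f : T1 * T2 -> \bar R) :
  measurable A -> measurable B -> measurable_fun setT f -> (forall z, 0 <= f z) ->
  \int[sprod m1 m2]_(z in A `*` B) f z =
  \int[m2]_(y in B) \int[m1]_(x in A) f (x, y).
Proof.
move=> mA mB mf f0; rewrite integral_mkcond.
have mr : measurable_fun setT (f \_ (A `*` B)).
  by apply/(measurable_restrictT _ (measurableX mA mB)); exact: measurable_funTS.
rewrite fubini_tonelli2//; last by move=> z; rewrite patchE; case: ifP.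
rewrite [RHS]integral_mkcond; apply: eq_integral => y _.
rewrite /fubini_G patchE; case: ifPn => yB.
  rewrite [RHS]integral_mkcond; apply: eq_integral => x _.
  by rewrite !patchE in_setX yB andbT.
by apply: integral0_eq => x _; rewrite patchE in_setX (negbTE yB) andbF.
Qed.

End integral_rectangle.

(** * The Lebesgue measure on R^d *)

Section shift_line.
Context {R : realType}.
Local Open Scope ereal_scope.

Definition shift_line (u : R) (t : measurableTypeR R) : measurableTypeR R :=
  (t + u)%R.

Let measurable_shift_line u : measurable_fun setT (shift_line u).
Proof. exact: measurable_funD. Qed.

HB.instance Definition _ u :=
  isMeasurableFun.Build _ _ _ _ (shift_line u) (measurable_shift_line u).

(** By uniqueness of the Lebesgue measure, half-open intervals are enough. *)
Lemma lebesgue_measure_shift (u : R) (A : set (measurableTypeR R)) :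
  measurable A ->
  lebesgue_measure A = pushforward lebesgue_measure (shift_line u) A.
Proof.
apply: lebesgue_measure_unique => _ [[a b] _ <-].
rewrite /= /pushforward /=.
rewrite [in RHS](_ : _ @^-1` _ = `]a - u, b - u]%classic)%R; last first.
  by apply/seteqP; split => t /=; rewrite !in_itv/= /shift_line ltrBlDr lerBrDr.
rewrite !lebesgue_measure_itv/= !lte_fin ltrD2r; case: ifP => // _.
by rewrite -!EFinB; congr EFin; ring.
Qed.

Lemma integral_lebesgue_shift (u : R) (f : measurableTypeR R -> \bar R) :
  measurable_fun setT f -> (forall t, 0 <= f t) ->
  \int[lebesgue_measure]_t f (t + u)%R = \int[lebesgue_measure]_t f t.
Proof.
move=> mf f0.
transitivity (\int[pushforward lebesgue_measure (shift_line u)]_t f t).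
  by rewrite ge0_integral_pushforward.
by apply: eq_measure_integral => A mA _; exact/esym/lebesgue_measure_shift.
Qed.

End shift_line.

Section lebesgue_Rd.
Context {R : realType}.
Local Open Scope ereal_scope.

Lemma integral_lebesgue_RdS d (f : Rd R d.+1 -> \bar R) :
  measurable_fun setT f -> (forall x, 0 <= f x) ->
  \int[lebesgue_Rd R d.+1]_x f x =
  \int[lebesgue_measure]_t \int[lebesgue_Rd R d]_x f [tuple of t :: x].
Proof.
move=> mf f0.
rewrite [LHS](_ : _ = \int[(@lebesgue_measure R \x lebesgue_Rd R d)%E]_z
   (f \o @cons_Rd R d) z); last by rewrite ge0_integral_pushforward.
rewrite fubini_tonelli1// => [|z]; last exact: f0.
by apply: (measurableT_comp mf); exact: measurable_funPT.
Qed.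

Lemma measurable_box d (I : 'I_d -> set R) :
  (forall k, measurable (I k : set (measurableTypeR R))) ->
  measurable [set x : Rd R d | forall k, I k (tnth x k)].
Proof.
move=> mI.
rewrite (_ : [set _ | _] = \bigcap_(k in [set: 'I_d])
    ((fun x : Rd R d => tnth x k) @^-1` I k)).
  apply: fin_bigcap_measurable => // k _.
  by rewrite -[X in measurable X]setTI; apply: measurable_tnth.
by apply/seteqP; split => x /= h k; [move=> _|]; exact: h.
Qed.

Lemma lebesgue_Rd_box d (I : 'I_d -> set R) :
  (forall k, measurable (I k : set (measurableTypeR R))) ->
  lebesgue_Rd R d [set x | forall k, I k (tnth x k)] =
  \prod_(k < d) lebesgue_measure (I k).
Proof.
elim: d I => [|d IH] I mI.
  rewrite big_ord0 /= diracE mem_set//= => -[] //.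
rewrite big_ord_recl.
pose B := [set x : Rd R d | forall k, I (lift ord0 k) (tnth x k)].
have mB : measurable B by apply: (@measurable_box _ (fun k => I (lift ord0 k))) => k; exact: mI.
rewrite -(IH (fun k => I (lift ord0 k)))// -/B /= /lebesgue_succ /pushforward.
rewrite (_ : _ @^-1` _ = I ord0 `*` B); first by rewrite product_measure1E.
apply/seteqP; split => -[t x] /=.
  by move=> h; split=> [|k]; [have := h ord0|have := h (lift ord0 k); rewrite tnthS].
by move=> [It Bx] k; case: (unliftP ord0 k) => [j|] ->; rewrite ?tnthS//; apply: Bx.
Qed.

Definition addRd d (x u : Rd R d) : Rd R d :=
  [tuple (tnth x k + tnth u k)%R | k < d].

Lemma measurable_addRd d :
  measurable_fun setT (fun z : Rdd R d => addRd z.1 z.2).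
Proof.
apply/measurable_fun_tnthP => k.
rewrite (_ : _ \o _ = fun z : Rdd R d => (tnth z.1 k + tnth z.2 k)%R); last first.
  by apply/funext => z /=; rewrite tnth_mktuple.
apply: measurable_funD.
  exact: (measurableT_comp (measurable_tnth k) measurable_fst).
exact: (measurableT_comp (measurable_tnth k) measurable_snd).
Qed.

(** Tonelli separates the first coordinate: the others are shifted by the induction hypothesis, the
    first by translation invariance on the line. *)
Lemma integral_lebesgue_Rd_shift d (u : Rd R d) (f : Rd R d -> \bar R) :
  measurable_fun setT f -> (forall x, 0 <= f x) ->
  \int[lebesgue_Rd R d]_x f (addRd x u) = \int[lebesgue_Rd R d]_x f x.
Proof.
elim: d u f => [|d IH] u f mf f0.
  by apply: eq_integral => x _; congr f; apply: eq_from_tnth => -[].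
have mshift (v : Rd R d.+1) : measurable_fun setT (fun x => addRd x v).
  have mp : measurable_fun setT (fun x : Rd R d.+1 => (x, v)).
    exact: measurable_fun_pair.
  exact: (measurableT_comp (@measurable_addRd d.+1) mp).
rewrite !integral_lebesgue_RdS//; last exact: (measurableT_comp mf).
have mfc : measurable_fun setT (f \o @cons_Rd R d).
  by apply: (measurableT_comp mf); exact: measurable_funPT.
pose u' : Rd R d := [tuple of behead u].
transitivity (\int[lebesgue_measure]_t \int[lebesgue_Rd R d]_x
    f [tuple of (t + thead u)%R :: x]).
  apply: eq_integral => t _.
  rewrite -(IH u' (fun x => f [tuple of (t + thead u)%R :: x]))//; last first.
    by apply: (measurableT_comp mf); exact: measurable_cons.
  apply: eq_integral => x _; congr f; apply: eq_from_tnth => k.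
  rewrite tnth_mktuple; case: (unliftP ord0 k) => [j|] -> //.
  by rewrite !tnthS tnth_mktuple /u' tnth_behead; congr (_ + tnth _ _)%R; apply: val_inj;
    rewrite /= inordK// ltnS ltn_ord.
apply: (integral_lebesgue_shift (thead u)
  (f := fun t => \int[lebesgue_Rd R d]_x f [tuple of t :: x])).
- exact: (measurable_fun_fubini_tonelli_F (m2 := lebesgue_Rd R d) _ mfc
    (fun z => f0 _)).
- by move=> t; apply: integral_ge0.
Qed.

End lebesgue_Rd.

(** * Moduli of smoothness as integrals over pairs of points *)

Notation leb2 R d := (sprod (lebesgue_Rd R d) (lebesgue_Rd R d)).
Notation leb4 R d := (sprod (leb2 R d) (leb2 R d)).

Section translate.
Context {R : realType} {d : nat}.
Local Open Scope ereal_scope.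

Lemma measurable_translate :
  measurable_fun setT (fun z : Rdd R d * Rdd R d => translate z.1 z.2).
Proof.
apply: measurable_fun_pair.
  have m : measurable_fun setT (fun z : Rdd R d * Rdd R d => (z.1.1, z.2.1)).
    by apply: measurable_fun_pair; exact: measurableT_comp.
  exact: (measurableT_comp (@measurable_addRd R d) m).
have m : measurable_fun setT (fun z : Rdd R d * Rdd R d => (z.1.2, z.2.2)).
  by apply: measurable_fun_pair; exact: measurableT_comp.
exact: (measurableT_comp (@measurable_addRd R d) m).
Qed.

Lemma translateC (z u : Rdd R d) : translate z u = translate u z.
Proof.
by congr pair; apply: eq_from_tnth => k; rewrite !tnth_mktuple addrC.
Qed.

Lemma measurable_translatel (u : Rdd R d) :
  measurable_fun setT (fun z : Rdd R d => translate z u).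
Proof.
have mp : measurable_fun setT (fun z : Rdd R d => (z, u)).
  exact: measurable_fun_pair.
exact: (measurableT_comp measurable_translate mp).
Qed.

Lemma integral_translate (u : Rdd R d) (f : Rdd R d -> \bar R) :
  measurable_fun setT f -> (forall x, 0 <= f x) ->
  \int[leb2 R d]_z f (translate z u) = \int[leb2 R d]_z f z.
Proof.
move=> mf f0.
rewrite !fubini_tonelli1//; last first.
  exact: (measurableT_comp mf (measurable_translatel u)).
rewrite /fubini_F.
transitivity (\int[lebesgue_Rd R d]_x (fun x => \int[lebesgue_Rd R d]_y f (x, y))
     (addRd x u.1)).
  apply: eq_integral => x _.
  apply: (integral_lebesgue_Rd_shift u.2 (f := fun y => f (addRd x u.1, y))) => //.
  by apply: (measurableT_comp mf); exact: measurable_fun_pair.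
apply: (integral_lebesgue_Rd_shift u.1
  (f := fun x => \int[lebesgue_Rd R d]_y f (x, y))).
  exact: (measurable_fun_fubini_tonelli_F (m2 := lebesgue_Rd R d) _ mf).
by move=> x; apply: integral_ge0.
Qed.

(** Substitute y = x + u for fixed x, then exchange the integrals. The displacement u becomes the
    outer variable, since a modulus of smoothness controls the inner integral for each u
    separately. *)
Lemma integral_leb4_translate (g : Rdd R d * Rdd R d -> \bar R) :
  measurable_fun setT g -> (forall z, 0 <= g z) ->
  \int[leb4 R d]_z g z =
  \int[leb2 R d]_u \int[leb2 R d]_x g (x, translate x u).
Proof.
move=> mg g0; rewrite fubini_tonelli1// /fubini_F.
have mtr : measurable_fun setT
    (fun z : Rdd R d * Rdd R d => (z.1, translate z.1 z.2)).
  by apply: measurable_fun_pair => //; exact: measurable_translate.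
rewrite -(@fubini_tonelli _ _ _ _ _ (leb2 R d) (leb2 R d)
  (fun z => g (z.1, translate z.1 z.2)))//=.
  apply: eq_integral => x _.
  rewrite -[LHS](integral_translate x)//.
    by apply: eq_integral => y _; rewrite translateC.
  by apply: (measurableT_comp mg); exact: measurable_fun_pair.
exact: (measurableT_comp mg mtr).
Qed.

End translate.

Section energy.
Context {R : realType} {d : nat}.
Local Open Scope ereal_scope.
Implicit Types (f : Rdd R d -> R) (p h : R).

Lemma measurable_unit_cube : measurable (@unit_cube R d).
Proof.
rewrite /unit_cube; apply: (@measurable_box _ _ (fun=> `[0%R, 1%R]%classic)) => k.
exact: measurable_itv.
Qed.

Lemma measurable_unit_cube2 : measurable (@unit_cube2 R d).
Proof. by apply: measurableX; exact: measurable_unit_cube. Qed.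

(** The sup norm suits cubes: the volume is explicit and two points of a dyadic cube of side h
    differ by an element of this ball. The Euclidean norm of [modulus] then costs a factor
    sqrt(2d). *)
Definition sup_ball (h : R) : set (Rdd R d) :=
  [set u | forall k, `|tnth u.1 k| <= h /\ `|tnth u.2 k| <= h]%R.

Let sup_ballE h : sup_ball h =
  [set x : Rd R d | forall k, `[(- h)%R, h]%classic (tnth x k)] `*`
  [set x : Rd R d | forall k, `[(- h)%R, h]%classic (tnth x k)].
Proof.
apply/seteqP; split => u /=.
  by move=> uh; split=> k; rewrite in_itv /= -ler_norml; case: (uh k).
by move=> [u1 u2] k; split; [have := u1 k|have := u2 k]; rewrite in_itv/= -ler_norml.
Qed.

Lemma measurable_sup_ball h : measurable (sup_ball h).
Proof.
rewrite sup_ballE; apply: measurableX;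
  apply: (@measurable_box _ _ (fun=> `[(- h)%R, h]%classic)) => k;
  exact: measurable_itv.
Qed.

Lemma leb2_sup_ball h : (0 <= h)%R ->
  leb2 R d (sup_ball h) = ((2 * h) ^+ (2 * d))%:E.
Proof.
move=> h0; rewrite sup_ballE /sprod.
have m := @measurable_box R d (fun=> `[(- h)%R, h]%classic) (fun=> measurable_itv _).
rewrite [LHS]product_measure1E//.
have box : lebesgue_Rd R d [set x | forall k, `[(- h)%R, h]%classic (tnth x k)] =
    ((2 * h) ^+ d)%:E.
  rewrite (lebesgue_Rd_box (I := fun=> `[(- h)%R, h]%classic)) => [|k]; last first.
    exact: measurable_itv.
  rewrite lebesgue_measure_itv/= lte_fin (eq_bigr (fun=> (2 * h)%:E)).
    elim: (d) => [|n IH]; first by rewrite big_ord0 expr0.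
    by rewrite big_ord_recl IH exprS EFinM.
  move=> k _; case: ltP => hh; first by rewrite -EFinB; congr EFin; ring.
  by congr EFin; lra.
by rewrite (_ : (_ * _)%E = ((2 * h) ^+ d)%:E * ((2 * h) ^+ d)%:E);
  [rewrite -EFinM -exprD addnn -mul2n|congr (_ * _)].
Qed.

Lemma euclidean_norm_sup_ball h u : (0 <= h)%R -> sup_ball h u ->
  (euclidean_norm u <= Num.sqrt (2 * d%:R) * h)%R.
Proof.
move=> h0 uh; rewrite /euclidean_norm.
rewrite -[X in (_ <= _ * X)%R](ger0_norm h0) -sqrtr_sqr -sqrtrM ?mulr_ge0//.
rewrite ler_wsqrtr//.
rewrite (@le_trans _ _ (\sum_(k < d) (h ^+ 2 + h ^+ 2))%R)//.
  apply: ler_sum => k _; have [u1 u2] := uh k.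
  by rewrite lerD// -real_normK ?num_real// lerXn2r// nnegrE ?normr_ge0.
rewrite big_const_ord iter_addr_0 -mulr_natl.
by rewrite le_eqVlt; apply/orP; left; apply/eqP; ring.
Qed.

Lemma Lp_norm_pow p f D : p != 0%R ->
  Lp_norm p f D `^ p = \int[leb2 R d]_(x in D) (`|f x| `^ p)%:E.
Proof.
move=> p0; rewrite /Lp_norm poweR_Lnorm// [RHS]integral_mkcond.
apply: eq_integral => x _; rewrite /patch; case: ifP => //= _.
by rewrite ?abse0 ?normr0 ?powR0 ?poweR0r.
Qed.

Definition near_diag h : set (Rdd R d * Rdd R d) :=
  [set z | unit_cube2 z.1 /\ unit_cube2 z.2 /\
     forall k, `|tnth z.1.1 k - tnth z.2.1 k| <= h /\
               `|tnth z.1.2 k - tnth z.2.2 k| <= h]%R.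

Lemma measurable_near_diag h : measurable (near_diag h).
Proof.
pose N := [set z : Rdd R d * Rdd R d | sup_ball h
  ([tuple (tnth z.1.1 k - tnth z.2.1 k)%R | k < d],
   [tuple (tnth z.1.2 k - tnth z.2.2 k)%R | k < d])].
have -> : near_diag h = (unit_cube2 `*` unit_cube2) `&` N.
  apply/seteqP; split => z /=.
    by move=> [Az1 [Az2 zh]]; split=> // k /=; rewrite !tnth_mktuple; exact: zh.
  move=> [[Az1 Az2] zh]; split=> //; split=> // k.
  by have := zh k; rewrite /= !tnth_mktuple.
apply: measurableI; first by apply: measurableX; exact: measurable_unit_cube2.
rewrite -[N]setTI.
have mdiff : measurable_fun setT (fun z : Rdd R d * Rdd R d =>
    ([tuple (tnth z.1.1 k - tnth z.2.1 k)%R | k < d],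
     [tuple (tnth z.1.2 k - tnth z.2.2 k)%R | k < d])).
  have mt k : measurable_fun setT (fun x : Rd R d => tnth x k).
    exact: measurable_tnth.
  apply: measurable_fun_pair; apply/measurable_fun_tnthP => k.
    rewrite (_ : _ \o _ = fun z => tnth z.1.1 k - tnth z.2.1 k)%R; last first.
      by apply/funext => z /=; rewrite tnth_mktuple.
    apply: measurable_funB.
      exact: (measurableT_comp (mt k) (measurableT_comp measurable_fst measurable_fst)).
    exact: (measurableT_comp (mt k) (measurableT_comp measurable_fst measurable_snd)).
  rewrite (_ : _ \o _ = fun z => tnth z.1.2 k - tnth z.2.2 k)%R; last first.
    by apply/funext => z /=; rewrite tnth_mktuple.
  apply: measurable_funB.
    exact: (measurableT_comp (mt k) (measurableT_comp measurable_snd measurable_fst)).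
  exact: (measurableT_comp (mt k) (measurableT_comp measurable_snd measurable_snd)).
by apply: mdiff => //; exact: measurable_sup_ball.
Qed.

Definition gap p f (z : Rdd R d * Rdd R d) : R := (`|f z.1 - f z.2| `^ p)%R.

Lemma measurable_gap p f : measurable_fun setT f ->
  measurable_fun setT (gap p f).
Proof.
move=> mf.
apply: (measurableT_comp (measurable_powR p)).
apply: (measurableT_comp (@normr_measurable R setT)).
apply: measurable_funB.
  exact: (measurableT_comp mf measurable_fst).
exact: (measurableT_comp mf measurable_snd).
Qed.

Lemma gap_ge0 p f z : (0 <= gap p f z)%R.
Proof. exact: powR_ge0. Qed.

(** For t >= 0 the zero displacement is admissible, so the supremum is not taken over the empty set,
    where it would be minus infinity. *)
Lemma modulus_ge0 p f t : (0 <= t)%R -> 0 <= modulus p f t.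
Proof.
move=> t0; pose z0 : Rdd R d := ([tuple 0%R | k < d], [tuple 0%R | k < d]).
apply: (@le_trans _ _ (Lp_norm p (fun z => f (translate z z0) - f z)%R
  [set z | unit_cube2 z /\ unit_cube2 (translate z z0)])).
  exact: Lnorm_ge0.
apply: ereal_sup_ubound; exists z0 => //=; apply: le_trans t0.
rewrite -[leRHS](mulr0 (Num.sqrt (2 * d%:R))).
by apply: euclidean_norm_sup_ball => // k; rewrite !tnth_mktuple normr0.
Qed.

(** For each displacement u in [sup_ball h] the integral in x is at most the p-th power of the
    modulus; integrating over u multiplies by the volume (2h)^(2d). *)
Lemma near_diag_energy_le p h f : (0 < p)%R -> (0 <= h)%R ->
  measurable_fun setT f ->
  \int[leb4 R d]_(z in near_diag h) (gap p f z)%:E <=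
  ((2 * h) ^+ (2 * d))%:E * modulus p f (Num.sqrt (2 * d%:R) * h) `^ p.
Proof.
move=> p0 h0 mf; rewrite integral_mkcond integral_leb4_translate; first last.
- by move=> z; rewrite patchE; case: ifP => // _; rewrite lee_fin gap_ge0.
- apply/(measurable_restrictT _ (measurable_near_diag h)).
  apply: measurable_funTS; apply/measurable_EFinP; exact: measurable_gap.
set M := modulus _ _ _.
have M0 : 0 <= M by apply: modulus_ge0; rewrite mulr_ge0.
rewrite -leb2_sup_ball// muleC -integral_cst//; last exact: measurable_sup_ball.
rewrite [leRHS]integral_mkcond.
apply: ge0_le_integral_nomeas => u _.
  by apply: integral_ge0 => x _; rewrite patchE; case: ifP => // _; rewrite lee_fin gap_ge0.
(* Outside the ball of displacements the integrand on the left vanishes. *)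
rewrite [leRHS]patchE; case: ifPn => [|/negP uh]; last first.
  rewrite integral0_eq// => x _; rewrite patchE ifF//; apply/negP => xh; apply: uh.
  move: xh; rewrite !inE => -[_ [_ xh]] k; have := xh k; rewrite /= !tnth_mktuple.
  have e (a b : R) : (a - (a + b) = - b)%R by ring.
  by rewrite !e !normrN.
rewrite inE => uh.
apply: (@le_trans _ _ (Lp_norm p (fun z => f (translate z u) - f z)%R
    [set z | unit_cube2 z /\ unit_cube2 (translate z u)] `^ p)); last first.
  apply: gt0_ler_poweR; rewrite ?in_itv/= ?leey ?Lnorm_ge0 ?M0 ?(ltW p0)//.
  by apply: ereal_sup_ubound; exists u => //=; apply: euclidean_norm_sup_ball.
rewrite Lp_norm_pow ?gt_eqF// [leRHS]integral_mkcond.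
apply: ge0_le_integral_nomeas => x _.
  by rewrite patchE; case: ifP => // _; rewrite lee_fin gap_ge0.
rewrite !patchE; case: ifPn => [|_]; last by case: ifPn => // _; rewrite lee_fin powR_ge0.
rewrite inE => -[/= Ax [Axu _]]; rewrite mem_set//.
by rewrite lee_fin /gap /= distrC.
Qed.

End energy.

(** * Dyadic cubes and partitions *)

Section dyadic.
Context {R : realType} {d : nat}.
Implicit Types (j : nat) (t : R) (z : Rdd R d).

(** Cubes of level j are indexed by a finite type, so that sums over a level or over the children of
    a cube are finite sums. Coordinates start from 0, hence the [.+1] in [cube]; the two summands of
    ['I_d + 'I_d] are the two blocks of axes. *)
Definition idx j := {ffun 'I_d + 'I_d -> 'I_(2 ^ j)}.

Definition coord z (k : 'I_d + 'I_d) : R :=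
  match k with inl i => tnth z.1 i | inr i => tnth z.2 i end.

(* The number, from [0], of the dyadic interval containing [t]. *)
Definition cell_nat j t : nat := minn (Num.truncn (2 ^+ j * t)) (2 ^ j).-1.

Lemma cell_nat_lt j t : (cell_nat j t < 2 ^ j)%N.
Proof. by have := expn_gt0 2 j; rewrite /cell_nat; lia. Qed.

Definition cell j z : idx j :=
  [ffun k => Ordinal (cell_nat_lt j (coord z k))].

Definition cube j (c : idx j) : set (Rdd R d) :=
  [set z | forall k, dyadic_side j (c (inl k)).+1 (tnth z.1 k) /\
                     dyadic_side j (c (inr k)).+1 (tnth z.2 k)].

Lemma dyadic_sideE j l t : (l < 2 ^ j)%N ->
  dyadic_side j l.+1 t <-> 0 <= t <= 1 /\ cell_nat j t = l.
Proof.
move=> lj; have e2 : (2 ^ j)%:R = 2 ^+ j :> R by rewrite natrX.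
have e20 : 0 < 2 ^+ j :> R by rewrite exprn_gt0.
have l1 : l.+1%:R - 1 = l%:R :> R by rewrite -natr1 addrK.
rewrite /dyadic_side /cell_nat; case: ifPn => [lj'|].
  have lle : l.+1%:R <= 2 ^+ j :> R by rewrite -e2 ler_nat ltnW.
  rewrite /= in_itv/= l1 ler_pdivrMr// ltr_pdivlMr// ![t * _]mulrC.
  split=> [/andP[lt tl]|[/andP[t0 t1]]].
    have t0 : 0 <= t by rewrite -(pmulr_rge0 _ e20) (le_trans _ lt).
    split; first by rewrite t0/= -(ler_pM2l e20) mulr1 (le_trans (ltW tl)).
    have -> : Num.truncn (2 ^+ j * t) = l by apply: truncn_def; rewrite lt tl.
    by apply/minn_idPl; lia.
  have x0 : 0 <= 2 ^+ j * t by rewrite mulr_ge0// ltW.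
  move=> h; have : Num.truncn (2 ^+ j * t) == l by lia.
  by rewrite truncn_eq.
(* The last interval is closed: the [minn] in [cell_nat] is what sends t = 1 to it. *)
rewrite -leqNgt => lj2; have {lj lj2} lj : l = (2 ^ j).-1 by lia.
have e2l : 2 ^+ j - 1 = l%:R :> R.
  by rewrite -l1 lj prednK ?expn_gt0// e2.
rewrite /= in_itv/= e2l ler_pdivrMr// mulrC.
split=> [/andP[lt t1]|[/andP[t0 t1] h]].
  have t0 : 0 <= t by rewrite -(pmulr_rge0 _ e20) (le_trans _ lt).
  rewrite t0 t1; split=> //; rewrite -lj; apply/minn_idPr.
  by rewrite truncn_ge_nat// mulr_ge0// ltW.
have x0 : 0 <= 2 ^+ j * t by rewrite mulr_ge0// ltW.
by rewrite t1 andbT -truncn_ge_nat// -[X in (X <= _)%N]h geq_minl.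
Qed.

Lemma cubeE j (c : idx j) z : cube c z <-> unit_cube2 z /\ cell j z = c.
Proof.
split=> [cz|[[z1 z2] <-] k]; last first.
  split; (apply/dyadic_sideE; rewrite ffunE /=; [exact: cell_nat_lt|by split]).
split.
  split=> k; have [h1 h2] := cz k.
    by move/dyadic_sideE: h1 => /(_ (ltn_ord _))[].
  by move/dyadic_sideE: h2 => /(_ (ltn_ord _))[].
apply/ffunP => -[k|k]; apply: val_inj; rewrite ffunE /=; have [h1 h2] := cz k.
  by move/dyadic_sideE: h1 => /(_ (ltn_ord _))[].
by move/dyadic_sideE: h2 => /(_ (ltn_ord _))[].
Qed.

Lemma cube_sub j (c : idx j) : cube c `<=` unit_cube2.
Proof. by move=> z /cubeE[]. Qed.

Lemma cube_cell j z : unit_cube2 z -> cube (cell j z) z.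
Proof. by move=> Az; apply/cubeE. Qed.

Lemma half_truncn2 (x : R) : 0 <= x -> (Num.truncn (2 * x))./2 = Num.truncn x.
Proof.
move=> x0; apply/esym/truncn_def.
have /truncn_itv : 0 <= 2 * x by rewrite mulr_ge0.
set n := Num.truncn _; have := odd_double_half n.
move=> /(congr1 (fun i => i%:R : R)); rewrite natrD -muln2 natrM => nE.
have : (odd n)%:R <= 1 :> R by case: (odd n) => //.
have : 0 <= (odd n)%:R :> R by [].
by rewrite -![_.+1%:R]natr1; lra.
Qed.

Lemma half_cell_nat j t : 0 <= t -> (cell_nat j.+1 t)./2 = cell_nat j t.
Proof.
move=> t0; rewrite /cell_nat.
have -> : 2 ^+ j.+1 * t = 2 * (2 ^+ j * t) by rewrite exprS mulrA.
have x0 : 0 <= 2 ^+ j * t by rewrite mulr_ge0// exprn_ge0.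
rewrite -(half_truncn2 x0) expnS; move: (Num.truncn _) => n.
have : (0 < 2 ^ j)%N by rewrite expn_gt0.
lia.
Qed.

Lemma half_lt j (l : 'I_(2 ^ j.+1)) : (l./2 < 2 ^ j)%N.
Proof. by have := ltn_ord l; have := expnS 2 j; lia. Qed.

Definition parent j (c : idx j.+1) : idx j :=
  [ffun k => Ordinal (half_lt (c k))].

Lemma parent_cell j z : unit_cube2 z -> parent (cell j.+1 z) = cell j z.
Proof.
move=> [z1 z2]; apply/ffunP => k; rewrite !ffunE; apply: val_inj => /=.
rewrite half_cell_nat//; case: k => k /=.
  by case/andP: (z1 k).
by case/andP: (z2 k).
Qed.

Lemma cube_parent j (c : idx j.+1) : cube c `<=` cube (parent c).
Proof. by move=> z /cubeE[Az <-]; apply/cubeE; rewrite parent_cell. Qed.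

Lemma card_idx j : #|{: idx j}| = ((2 ^ j) ^ (2 * d))%N.
Proof. by rewrite card_ffun card_sum !card_ord addnn mul2n. Qed.

(** A child is determined by its parent and the parities of its 2d coordinates. *)
Lemma card_children j (E : {pred idx j}) :
  (#|[pred c : idx j.+1 | parent c \in E]| <= #|E| * 2 ^ (2 * d))%N.
Proof.
pose F (c : idx j.+1) : idx j * {ffun 'I_d + 'I_d -> bool} :=
  (parent c, [ffun k => odd (c k)]).
have Finj : injective F.
  move=> c c' [/ffunP pc /ffunP oc]; apply/ffunP => k; apply: val_inj => /=.
  have := pc k; rewrite !ffunE => /(congr1 val)/= h.
  have := oc k; rewrite !ffunE => o.
  by rewrite -[LHS]odd_double_half -[RHS]odd_double_half h o.
rewrite -(fintype.card_image Finj).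
apply: (@leq_trans #|[predX E & {: {ffun 'I_d + 'I_d -> bool}}]|).
  apply: subset_leq_card; apply/fintype.subsetP => _ /fintype.imageP[c cE ->].
  by rewrite inE /= andbT.
by rewrite cardX card_ffun card_sum !card_ord card_bool addnn mul2n.
Qed.

Lemma cube0 (c : idx 0) : cube c = unit_cube2.
Proof.
apply/seteqP; split; first exact: cube_sub.
move=> z Az; apply/cubeE; split=> //; apply/ffunP => k; apply: val_inj => /=.
have o (i : 'I_(2 ^ 0)) : i = 0%N :> nat by case: i => -[].
by rewrite !o.
Qed.

Lemma cube_dyadic j (c : idx j) : dyadic_cubes j (cube c).
Proof.
exists (fun k => (c (inl k)).+1), (fun k => (c (inr k)).+1).
by split=> // k; rewrite ltn_ord.
Qed.

Lemma dyadic_cubeP j (K : set (Rdd R d)) :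
  dyadic_cubes j K -> exists c : idx j, K = cube c.
Proof.
move=> [l [l' [hl hl' ->]]].
have lt k : ((l k).-1 < 2 ^ j)%N by have := hl k; lia.
have lt' k : ((l' k).-1 < 2 ^ j)%N by have := hl' k; lia.
exists [ffun k => match k with inl i => Ordinal (lt i) | inr i => Ordinal (lt' i) end].
apply/seteqP; split => z h k; have := h k; rewrite !ffunE/= !prednK//.
- by have := hl' k; lia.
- by have := hl k; lia.
- by have := hl' k; lia.
- by have := hl k; lia.
Qed.

Lemma measurable_dyadic_side j l :
  measurable (dyadic_side j l : set (measurableTypeR R)).
Proof. by rewrite /dyadic_side; case: ifP => _; exact: measurable_itv. Qed.

Let cubeX j (c : idx j) : cube c =
  [set x : Rd R d | forall k, dyadic_side j (c (inl k)).+1 (tnth x k)] `*`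
  [set x : Rd R d | forall k, dyadic_side j (c (inr k)).+1 (tnth x k)].
Proof.
apply/seteqP; split => z /= h.
  by split=> k; have [] := h k.
by move=> k; case: h.
Qed.

Lemma measurable_cube j (c : idx j) : measurable (cube c).
Proof.
rewrite cubeX; apply: measurableX.
  by apply: (@measurable_box _ _ (fun k => dyadic_side j (c (inl k)).+1)) => k;
    exact: measurable_dyadic_side.
by apply: (@measurable_box _ _ (fun k => dyadic_side j (c (inr k)).+1)) => k;
  exact: measurable_dyadic_side.
Qed.

Lemma lebesgue_dyadic_side j l : (l < 2 ^ j)%N ->
  lebesgue_measure (dyadic_side j l.+1 : set R) = (2 ^- j)%:E.
Proof.
move=> lj; have e20 : 0 < 2 ^+ j :> R by rewrite exprn_gt0.
have vol : forall a b : R, b - a = 2 ^- j -> (a < b) * (b - a = 2 ^- j).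
  by move=> a b h; rewrite -subr_gt0 h invr_gt0.
rewrite /dyadic_side; case: ifP => _; rewrite lebesgue_measure_itv/= lte_fin.
  have [-> h] : (l.+1%:R - 1) / 2 ^+ j < l.+1%:R / 2 ^+ j :> R /\
     (l.+1%:R / 2 ^+ j - (l.+1%:R - 1) / 2 ^+ j = 2 ^- j :> R).
    have h : l.+1%:R / 2 ^+ j - (l.+1%:R - 1) / 2 ^+ j = 2 ^- j :> R.
      by rewrite -mulrBl opprB addrC subrK mul1r.
    by split=> //; case: (vol _ _ h).
  by rewrite -EFinB h.
have h : 1 - (2 ^+ j - 1) / 2 ^+ j = 2 ^- j :> R.
  by rewrite mulrBl mul1r divff ?gt_eqF// opprB addrC subrK.
by have [-> _] := vol _ _ h; rewrite -EFinB h.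
Qed.

Definition vol j : R := (2 ^- j) ^+ (2 * d).

Lemma vol_gt0 j : 0 < vol j.
Proof. by rewrite exprn_gt0// invr_gt0 exprn_gt0. Qed.

Lemma vol_exprE j : vol j = (2 ^+ (2 * d)) ^- j.
Proof. by rewrite /vol exprVn -!exprM mulnC. Qed.

Lemma leb2_cube j (c : idx j) : leb2 R d (cube c) = (vol j)%:E.
Proof.
have box (F : 'I_d -> 'I_(2 ^ j)) :
    lebesgue_Rd R d [set x | forall k, dyadic_side j (F k).+1 (tnth x k)] =
    ((2 ^- j) ^+ d)%:E.
  rewrite (lebesgue_Rd_box (I := fun k => dyadic_side j (F k).+1)) => [|k]; last first.
    exact: measurable_dyadic_side.
  rewrite (eq_bigr (fun=> (2 ^- j)%:E)) => [|k _]; last exact: lebesgue_dyadic_side.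
  elim: (d) => [|n IH]; first by rewrite big_ord0 expr0.
  by rewrite big_ord_recl IH exprS EFinM.
rewrite cubeX /sprod [LHS]product_measure1E; last 2 first.
- by apply: (@measurable_box _ _ (fun k => dyadic_side j (c (inl k)).+1)) => k;
    exact: measurable_dyadic_side.
- by apply: (@measurable_box _ _ (fun k => dyadic_side j (c (inr k)).+1)) => k;
    exact: measurable_dyadic_side.
rewrite (_ : (_ * _)%E = ((2 ^- j) ^+ d)%:E * ((2 ^- j) ^+ d)%:E)%E.
  by rewrite -EFinM -exprD addnn -mul2n.
by congr (_ * _)%E; [exact: (box (fun k => c (inl k)))|exact: (box (fun k => c (inr k)))].
Qed.

Lemma cube_nonempty j (c : idx j) : exists z, cube c z.
Proof.
have [K0|/set0P[z cz]] := eqVneq (cube c) set0; last by exists z.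
by have := leb2_cube c; rewrite K0 measure0 => /esym[/eqP]; rewrite gt_eqF// vol_gt0.
Qed.

Lemma cube_near_diag j (c : idx j) : cube c `*` cube c `<=` near_diag (2 ^- j).
Proof.
have side l (s t : R) : dyadic_side j l s -> dyadic_side j l t ->
    `|s - t| <= 2 ^- j.
  have e20 : 0 < 2 ^+ j :> R by rewrite exprn_gt0.
  have aux a b : b - a = 2 ^- j -> a <= s <= b -> a <= t <= b -> `|s - t| <= 2 ^- j.
    by move=> h sab tab; rewrite ler_norml; lra.
  rewrite /dyadic_side; case: ifP => _ /=; rewrite !in_itv/= => /andP[s1 s2] /andP[t1 t2].
    apply: (aux ((l%:R - 1) / 2 ^+ j) (l%:R / 2 ^+ j)); rewrite ?s1 ?t1/= ?ltW//.
    by rewrite -mulrBl opprB addrC subrK mul1r.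
  apply: (aux ((2 ^+ j - 1) / 2 ^+ j) 1); rewrite ?s1 ?t1/= ?s2 ?t2//.
  by rewrite mulrBl mul1r divff ?gt_eqF// opprB addrC subrK.
move=> [x y] [/= cx cy]; split; first exact: cube_sub cx.
split; first exact: cube_sub cy.
move=> k /=; have [x1 x2] := cx k; have [y1 y2] := cy k.
by split; [exact: side x1 y1|exact: side x2 y2].
Qed.

(** [dyadic_child] speaks of sets and of some level; the volume recovers the level of a cube from
    the set. *)
Lemma vol_inj : (0 < d)%N -> injective vol.
Proof.
move=> d0 i j; rewrite /vol => /eqP.
rewrite eqrXn2 ?muln_gt0// ?invr_ge0 ?exprn_ge0// => /eqP/invr_inj/eqP.
rewrite -!natrX eqr_nat eqn_exp2l// => /eqP //.
Qed.

Lemma dyadic_childP j (c : idx j) (K : set (Rdd R d)) : (0 < d)%N ->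
  dyadic_child (cube c) K <-> exists2 c' : idx j.+1, parent c' = c & K = cube c'.
Proof.
move=> d0; split=> [[i [/dyadic_cubeP[ci ciE]]]|[c' <- ->]]; last first.
  by exists j; split; [exact: cube_dyadic|exact: cube_dyadic|exact: cube_parent].
have ij : i = j.
  by apply: vol_inj => //; have := leb2_cube c; rewrite ciE leb2_cube => -[].
subst i => /dyadic_cubeP[c' ->] cc'; exists c' => //.
have [z cz] := cube_nonempty c'.
have := cc' _ cz; move/cubeE => [Az <-]; move/cubeE: cz => [_ <-].
exact: parent_cell.
Qed.

End dyadic.

(** * Inequalities for real powers and geometric sums *)

Section real_lemmas.
Context {R : realType}.
Implicit Types (x y : R).

Lemma exprn_powR x n y : 0 <= x -> (x ^+ n) `^ y = x `^ (n%:R * y).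
Proof. by move=> x0; rewrite -[x ^+ n]powR_mulrn// powRrM. Qed.

Lemma powR_exprn x n y : 0 <= x -> (x `^ y) ^+ n = x `^ (y * n%:R).
Proof. by move=> x0; rewrite -[LHS]powR_mulrn ?powR_ge0// powRrM. Qed.

Lemma invr_powR x y : 0 <= x -> x^-1 `^ y = x `^ (- y).
Proof. by move=> x0; rewrite -[x^-1]powR_inv1// -powRrM mulN1r. Qed.

Lemma powRN_lt1 x y : 1 < x -> 0 < y -> x `^ (- y) < 1.
Proof.
move=> x1 y0; have x0 : 0 < x by exact: lt_trans x1.
rewrite powRN invf_lt1 ?powR_gt0//.
have : 1 `^ y < x `^ y by apply: gt0_ltr_powR; rewrite ?nnegrE// ltW.
by rewrite powR1.
Qed.

(** Superadditivity of the power e >= 1: write x^e = x x^(e-1) and bound the second factor, which is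
    monotone, by its value at the sum. *)
Lemma sum_powR_le (I : Type) (s : seq I) (P : pred I) (x : I -> R) (e : R) :
  1 <= e -> (forall i, 0 <= x i) ->
  \sum_(i <- s | P i) x i `^ e <= (\sum_(i <- s | P i) x i) `^ e.
Proof.
move=> e1 x0; set S := \sum_(i <- s | P i) x i.
have S0 : 0 <= S by apply: sumr_ge0.
have xe y : 0 <= y -> y `^ e = y * y `^ (e - 1).
  by move=> y0; rewrite mulr_powRB1// (lt_le_trans _ e1).
elim: s @S S0 => [|i s IH] S S0; first by rewrite !big_nil powR_ge0.
rewrite /S !big_cons; case: ifP => Pi; last exact/IH/sumr_ge0.
have := IH (sumr_ge0 _ (fun i _ => x0 i)) => {}IH.
set T := \sum_(j <- s | P j) x j in IH *.
have T0 : 0 <= T by apply: sumr_ge0.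
apply: (le_trans (lerD (lexx _) IH)).
rewrite (xe _ (x0 i)) (xe _ T0) (xe _ (addr_ge0 (x0 i) T0)) mulrDl.
by apply: lerD; apply: ler_wpM2l => //; apply: ge0_ler_powR;
  rewrite ?subr_ge0 ?nnegrE ?addr_ge0// ?lerDl ?lerDr.
Qed.

(** Serves twice: to discard the remainder at infinite depth in the recursion over the tree, and to
    find a level at which no cube has to be divided. *)
Lemma le0_of_geometric x y (r : R) : 0 <= r < 1 ->
  (forall n, x <= r ^+ n * y) -> x <= 0.
Proof.
move=> /andP[r0 r1] h.
have cv : (fun n => r ^+ n * y) @ \oo --> 0 * y.
  by apply: cvgMl; apply: cvg_expr; rewrite ger0_norm.
rewrite mul0r in cv; rewrite -(cvg_lim _ cv)//.
by apply: limr_ge => //; [apply/cvg_ex; exists 0|exact: nearW].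
Qed.

(* [G X = min X 1 - c min (X^-tau) 1] increases by at least
   [min X (X^-tau)] from [X] to [b X]. *)
Lemma sum_min_powR_le (b tau : R) : 4 <= b -> 0 < tau ->
  exists2 C : R, 0 < C & forall (N : R) (n_ : nat -> R) (J : nat), 0 < N ->
    (forall j, n_ j <= b ^+ j) ->
    (forall j, n_ j <= N * (b ^+ j / N) `^ (- tau)) ->
    \sum_(j < J) n_ j <= C * N.
Proof.
move=> b4 tau0; pose k : R := 2 `^ (- tau).
have k0 : 0 < k by exact: powR_gt0.
have k1 : k < 1 by apply: powRN_lt1; rewrite ?ltr1n.
(* Since b^(-tau) <= k, going from X >= 1 to b X decreases X^(-tau) by at least (1 - k) X^(-tau);
   the factor [c] makes this gain at least X^(-tau). *)
pose c := (1 - k)^-1.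
have c0 : 0 < c by rewrite invr_gt0 subr_gt0.
have ck : c * (1 - k) = 1 by rewrite mulVf// gt_eqF// subr_gt0.
pose G x : R := Num.min x 1 - c * Num.min (x `^ (- tau)) 1.
have b0 : 0 < b by lra.
have powN x y : 0 < x -> x <= y -> y `^ (- tau) <= x `^ (- tau).
  move=> x0 xy; rewrite !powRN lef_pV2 ?posrE ?powR_gt0//; last exact: lt_le_trans xy.
  by apply: ge0_ler_powR; rewrite ?nnegrE ?(ltW tau0)// ltW// (lt_le_trans x0).
have pow1 : 1 `^ (- tau) = 1 :> R by rewrite powR1.
have step x : 0 < x -> Num.min x (x `^ (- tau)) <= G (b * x) - G x.
  move=> x0; rewrite /G powRM ?(ltW b0) ?(ltW x0)//.
  set y := x `^ (- tau); set kb := b `^ (- tau).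
  have y0 : 0 < y by exact: powR_gt0.
  have kb0 : 0 < kb by exact: powR_gt0.
  have kbk : kb <= k by apply: powN; lra.
  have [x1|x1] := leP 1 x.
    have y1 : y <= 1 by rewrite -pow1; apply: powN.
    have bx1 : 1 <= b * x by nra.
    have ky1 : kb * y <= 1 by nra.
    rewrite (min_idPr bx1) (min_idPl ky1) (min_idPl y1).
    have : c * (1 - kb) >= 1 by nra.
    have : Num.min x y <= y by rewrite ge_min lexx orbT.
    nra.
  have y1 : 1 <= y by rewrite -pow1; apply: powN => //; exact: ltW.
  have mx : Num.min x y <= x by rewrite ge_min lexx.
  rewrite (min_idPr y1).
  have [bx1|bx1] := leP (b * x) 1.
    have ky1 : 1 <= kb * y.
      rewrite /kb /y -powRM ?(ltW b0) ?(ltW x0)// -pow1; apply: powN => //.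
      by rewrite mulr_gt0.
    by rewrite (min_idPr ky1); nra.
  have ky1 : kb * y <= 1.
    rewrite /kb /y -powRM ?(ltW b0) ?(ltW x0)// -pow1; apply: powN => //.
    exact: ltW.
  rewrite (min_idPl ky1).
  (* If X <= 1/2, the first term of [G] gains 1 - X >= X. Otherwise b X >= 2 because b >= 4, and the
     second term gains at least c (1 - k) = 1. *)
  have [x2|x2] := leP x (2^-1); first by nra.
  have : kb * y <= k.
    rewrite /kb /y -powRM ?(ltW b0) ?(ltW x0)//; apply: powN => //; nra.
  by nra.
have Gle x : 0 < x -> G x <= 1.
  move=> x0; rewrite /G.
  have : Num.min x 1 <= 1 by rewrite ge_min lexx orbT.
  have : 0 <= Num.min (x `^ (- tau)) 1 by rewrite le_min powR_ge0 ler01.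
  by nra.
have Gge x : 0 < x -> - c <= G x.
  move=> x0; rewrite /G.
  have : 0 <= Num.min x 1 by rewrite le_min (ltW x0) ler01.
  have : Num.min (x `^ (- tau)) 1 <= 1 by rewrite ge_min lexx orbT.
  by nra.
exists (1 + c); first by lra.
move=> N n_ J N0 n1 n2.
have bJ j : 0 < b ^+ j / N by rewrite divr_gt0// exprn_gt0.
(* With X = b^j / N the increments of [G] telescope over the levels, and [G] stays between [- c] and
   1. *)
have n_G j : n_ j <= N * (G (b ^+ j.+1 / N) - G (b ^+ j / N)).
  rewrite exprS -mulrA; apply: le_trans (ler_wpM2l (ltW N0) (step _ (bJ j))).
  rewrite minr_pMr ?(ltW N0)// le_min n2 andbT.
  by rewrite mulrC divfK ?gt_eqF.
apply: (@le_trans _ _ (N * (G (b ^+ J / N) - G (b ^+ 0 / N)))).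
  elim: J => [|J IH]; first by rewrite big_ord0 subrr mulr0.
  by rewrite big_ord_recr /=; have := n_G J; nra.
rewrite mulrC ler_wpM2r ?(ltW N0)//.
by have := Gle _ (bJ J); have := Gge _ (bJ 0); lra.
Qed.

End real_lemmas.

Section tree_recursion.
Context {R : realType} {d : nat}.
Local Notation idx := (@idx d).

(** Here [w] is an error and [a] a superadditive energy. Unfolding n times leaves a remainder of
    order ((1 + eps) q)^n, coming from the crude bound [B], which disappears as n grows. The
    constant A = C / (1 - (1 + eps) r) is the fixed point of A = (1 + eps) r A + C, and
    superadditivity of [a] and of the power [e] sums the energies of the children. *)
Lemma tree_recursion (w a : forall j, idx j -> R) (eps q r B C e : R) :
  0 <= eps -> 0 <= q -> 0 <= r -> 0 <= B -> 0 <= C -> 1 <= e ->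
  (1 + eps) * q < 1 -> (1 + eps) * r < 1 ->
  (forall j c, 0 <= a j c) ->
  (forall j c, \sum_(c' : idx j.+1 | parent c' == c) a j.+1 c' <= a j c) ->
  (forall j c, w j c <= B * (q ^+ j * a j c)) ->
  (forall j c, w j c <=
     (1 + eps) * \sum_(c' : idx j.+1 | parent c' == c) w j.+1 c' +
     C * (r ^+ j * a j c `^ e)) ->
  forall j c, w j c <= C / (1 - (1 + eps) * r) * (r ^+ j * a j c `^ e).
Proof.
move=> eps0 q0 r0 B0 C0 e1 q1 r1 a0 asum wB wC j c.
set A := C / _.
have A0 : 0 <= A by rewrite divr_ge0// subr_ge0 ltW.
have AE : (1 + eps) * r * A + C = A.
  rewrite /A; field; rewrite gt_eqF// subr_gt0//.
pose rho := (1 + eps) * q.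
have rho0 : 0 <= rho by rewrite mulr_ge0//; lra.
suff key n : forall j c, w j c <=
    A * (r ^+ j * a j c `^ e) + rho ^+ n * (B * (q ^+ j * a j c)).
  rewrite -subr_le0; apply: (@le0_of_geometric _ _ (B * (q ^+ j * a j c)) rho).
    by rewrite rho0.
  by move=> n; rewrite lerBlDl.
elim: n => {j c} [|n IH] j c.
  by rewrite expr0 mul1r; apply: le_trans (wB j c) _; 
  rewrite lerDr mulr_ge0// mulr_ge0 ?exprn_ge0 ?powR_ge0.
apply: le_trans (wC j c) _.
have sw : \sum_(c' : idx j.+1 | parent c' == c) w j.+1 c' <=
    A * (r ^+ j.+1 * a j c `^ e) + rho ^+ n * (B * (q ^+ j.+1 * a j c)).
  apply: le_trans (ler_sum _ (fun c' _ => IH j.+1 c')) _.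
  rewrite big_split /= -!mulr_sumr lerD//.
    rewrite !ler_wpM2l ?exprn_ge0//.
    apply: le_trans (sum_powR_le _ _ e1 _) _ => //.
    apply: ge0_ler_powR; rewrite ?nnegrE ?sumr_ge0//; last exact: asum.
    exact: le_trans ler01 e1.
  by rewrite !ler_wpM2l ?exprn_ge0//; exact: asum.
have e1' : 0 <= 1 + eps by lra.
apply: (le_trans (lerD (ler_wpM2l e1' sw) (lexx _))).
rewrite le_eqVlt; apply/orP; left; apply/eqP.
rewrite -[in RHS]AE /rho !exprS; ring.
Qed.

End tree_recursion.

(** * Partitions obtained from prescribed divisions *)

Section partition_builder.
Context {R : realType} {d : nat}.
Local Notation idx := (@idx d).
Local Notation cube := (@cube R d).

(** At step j the current cubes of level j that lie in [E j] are divided, which adds at most 2^(2d)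
    pieces for each. A piece of level below [J] has been examined and kept, so it is outside [E j];
    those of level [J] have not been examined yet. *)
Lemma exists_partition (E : forall j, {pred idx j}) (J : nat) : (0 < d)%N ->
  exists m : {fset set (Rdd R d)},
  [/\ partition_after J m,
      (#|` m| <= 1 + \sum_(j < J) #|E j| * 2 ^ (2 * d))%N,
      (forall K, K \in m -> exists j (c : idx j),
         [/\ K = cube c, (j <= J)%N & c \in E j -> j = J]),
      (forall K K' z, K \in m -> K' \in m -> K z -> K' z -> K = K') &
      forall z, unit_cube2 z -> exists2 K, K \in m & K z].
Proof.
move=> d0; elim: J => [|J [m [pm cm lm dm um]]].
  exists [fset unit_cube2]%fset; split.
  - exact: partition_after0.
  - by rewrite cardfs1 big_ord0.
  - move=> K; rewrite inE => /eqP ->.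
    pose c : idx 0 := [ffun=> Ordinal (erefl (0 < 2 ^ 0)%N)].
    by exists 0%N, c; split=> //; rewrite cube0.
  - by move=> K K' z /fset1P -> /fset1P ->.
  - by move=> z Az; exists unit_cube2; rewrite ?inE.
pose D := [fset K in m | `[< exists2 c : idx J, c \in E J & K = cube c >]]%fset.
(* Membership of the parent in [m] is required because a cube of [E J] may lie inside a larger piece
   that was kept earlier. *)
pose N := [fset cube c' | c' in [pred c' : idx J.+1 |
   (parent c' \in E J) && (cube (parent c') \in m)]]%fset.
have DP K : K \in D <-> K \in m /\ exists2 c : idx J, c \in E J & K = cube c.
  by rewrite !inE; split=> [/andP[Km /asboolP]|[Km /asboolP h]] //; apply/andP.
have NP K : K \in N <-> exists2 c' : idx J.+1,
    (parent c' \in E J) && (cube (parent c') \in m) & K = cube c'.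
  by split=> [/imfsetP[c' /= h ->]|[c' h ->]]; [exists c'|apply/imfsetP; exists c'].
have ND c' : (parent c' \in E J) && (cube (parent c') \in m) -> cube (parent c') \in D.
  by move=> /andP[h1 h2]; apply/DP; split=> //; exists (parent c').
exists ((m `\` D) `|` N)%fset; split.
- apply: (partition_afterS pm); exists D; split.
    by apply/fsubsetP => K /DP[].
  move=> K; rewrite in_fsetU in_fsetD; split.
    case/orP => [/andP[KD Km]|/NP[c' h ->]]; first by left.
    right; exists (cube (parent c')); first exact: ND.
    by apply/dyadic_childP => //; exists c'.
  move=> [[Km KD]|[K' /DP[K'm [c cE K'E]] child]]; apply/orP; first by left; rewrite KD.
  right; apply/NP; move: child; rewrite K'E => /(dyadic_childP _ _ d0)[c' pc' ->].
  by exists c' => //; rewrite pc' cE -K'E.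
- rewrite big_ord_recr /= addnA; rewrite cardfsU; apply: leq_trans (leq_subr _ _) _.
  apply: leq_add.
    by apply: leq_trans cm; apply: fsubset_leq_card; apply: fsubsetDl.
  apply: leq_trans (card_children (E J)); rewrite /N.
  apply: leq_trans (leq_imfset_card _ _ _) _.
  rewrite /= -cardE; apply: subset_leq_card; apply/fintype.subsetP => c'.
  by rewrite !inE => /andP[].
- move=> K; rewrite in_fsetU in_fsetD => /orP[/andP[KD Km]|/NP[c' h ->]]; last first.
    by exists J.+1, c'.
  have [j [c [KE jJ cE]]] := lm _ Km; exists j, c; split=> //; first exact: leqW.
  move=> cEj; have jE := cE cEj; subst j; exfalso; move/negP: KD; apply.
  by apply/DP; split=> //; exists c.
(* A kept piece that meets a new child meets the parent of that child, hence is that parent, which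
   has been divided. *)
- have old K c' z : K \notin D -> K \in m -> K z ->
    (parent c' \in E J) && (cube (parent c') \in m) -> cube c' z -> False.
    move=> KD Km Kz h cz; move/negP: KD; apply.
    rewrite (dm K (cube (parent c')) z)//; first exact: ND.
      by case/andP: h.
    exact: cube_parent cz.
  move=> K K' z; rewrite !in_fsetU !in_fsetD.
  case/orP => [/andP[KD Km]|/NP[c h ->]]; case/orP => [/andP[KD' Km']|/NP[c' h' ->]].
  + exact: dm.
  + by move=> Kz cz; have := old _ _ _ KD Km Kz h' cz.
  + by move=> cz Kz; have := old _ _ _ KD' Km' Kz h cz.
  + by move=> /cubeE[_ <-] /cubeE[_ <-].
- move=> z Az; have [K Km Kz] := um _ Az.
  have [KD|KD] := boolP (K \in D); last first.
    by exists K => //; rewrite in_fsetU in_fsetD KD Km.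
  have /DP[_ [c cE KE]] := KD; exists (cube (cell J.+1 z)); last exact: cube_cell.
  have cc : cell J z = c by move: Kz; rewrite KE => /cubeE[].
  rewrite in_fsetU; apply/orP; right; apply/NP; exists (cell J.+1 z) => //.
  by rewrite parent_cell// cc cE -KE Km.
Qed.

End partition_builder.

(** * Uniform approximation: p >= 2 *)

Section cube_values.
Context {R : realType} {d : nat}.
Local Notation idx := (@idx d).
Local Notation cube := (@cube R d).
Local Notation vol := (@vol R d).
Implicit Types (f : Rdd R d -> R) (p : R).

Lemma leb2_cube_gt0 j (c : idx j) : (0 < leb2 R d (cube c))%E.
Proof. by rewrite leb2_cube lte_fin vol_gt0. Qed.

Lemma measurable_cube2 j (c : idx j) : measurable (cube c `*` cube c).
Proof. by apply: measurableX; exact: @measurable_cube. Qed.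

Lemma leb4_cube2 j (c : idx j) :
  leb4 R d (cube c `*` cube c) = (vol j * vol j)%:E.
Proof.
have mc : measurable (cube c) by exact: @measurable_cube.
rewrite EFinM -{1}(leb2_cube c) -(leb2_cube c).
exact: (product_measure1E (leb2 R d) (leb2 R d) mc mc).
Qed.

Lemma measurable_EFin_gap p f : measurable_fun setT f ->
  measurable_fun setT (fun z => (gap p f z)%:E).
Proof. by move=> mf; apply/measurable_EFinP; exact: measurable_gap. Qed.

Lemma exists_cube_value p f j (c : idx j) (b : R) : measurable_fun setT f ->
  0 <= b ->
  (\int[leb4 R d]_(z in cube c `*` cube c) (gap p f z)%:E <= (b * vol j)%:E)%E ->
  exists2 y, cube c y &
    (\int[leb2 R d]_(x in cube c) (gap p f (x, y))%:E <= b%:E)%E.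
Proof.
move=> mf b0; have mc := @measurable_cube R d _ c.
have mg := measurable_EFin_gap p mf.
rewrite integral_rectangle//; last by move=> z; rewrite lee_fin gap_ge0.
move=> hb; apply: (@exists_le_mean _ _ _ (leb2 R d) (cube c)
   (fun y => \int[leb2 R d]_(x in cube c) (gap p f (x, y))%:E)%E) => //.
- exact: leb2_cube_gt0.
- by rewrite [X in (X < _)%E](leb2_cube c) ltry.
- apply: measurable_funTS.
  pose g (z : Rdd R d * Rdd R d) : \bar R := (gap p f z)%:E.
  have mD : measurable (cube c `*` [set: Rdd R d]) by exact: measurableX.
  have mr : measurable_fun setT (g \_ (cube c `*` [set: Rdd R d])).
    apply/(measurable_restrictT g mD).
    exact: measurable_funTS.
  rewrite (_ : (fun y => _) = fubini_G (leb2 R d) (g \_ (cube c `*` [set: Rdd R d]))).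
    apply: (@measurable_fun_fubini_tonelli_G _ _ _ _ _ (leb2 R d) _ mr) => z.
    by rewrite patchE; case: ifP => // _; rewrite lee_fin gap_ge0.
  apply/funext => y; rewrite /fubini_G [LHS]integral_mkcond; apply: eq_integral => x _.
  by rewrite !patchE in_setX in_setT andbT.
- by move=> x _; apply: integral_ge0 => y _; rewrite lee_fin gap_ge0.
- by rewrite [X in (_ * X)%E](leb2_cube c) -EFinM.
Qed.

Lemma gap2E f z : gap 2 f z = (f z.1 - f z.2) ^+ 2.
Proof. by rewrite /gap powR_mulrn ?normr_ge0// real_normK ?num_real. Qed.

Lemma exists_step_values f (m : {fset set (Rdd R d)}) (B : set (Rdd R d) -> R) :
  measurable_fun setT f -> (forall x, 0 <= f x) ->
  (forall K, 0 <= B K) ->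
  (forall K, K \in m -> exists j (c : idx j), K = cube c /\
     (\int[leb4 R d]_(z in K `*` K) (gap 2 f z)%:E <= (B K * vol j)%:E)%E) ->
  exists2 v : set (Rdd R d) -> R, (forall K, 0 <= v K) &
    (\sum_(K <- m) \int[leb2 R d]_(x in K) ((f x - v K) ^+ 2)%:E <=
     (\sum_(K <- m) B K)%:E)%E.
Proof.
move=> mf f0 B0 hm.
have /choice[v hv] : forall K, exists v : R, 0 <= v /\ (K \in m ->
    (\int[leb2 R d]_(x in K) ((f x - v) ^+ 2)%:E <= (B K)%:E)%E).
  move=> K; have [Km|Km] := boolP (K \in m); last by exists 0.
  have [j [c [KE hK]]] := hm _ Km; move: hK; rewrite {1 2}KE => hK.
  have [y cy hy] := exists_cube_value mf (B0 K) hK.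
  exists (f y); split=> // _; apply: le_trans hy; rewrite {1}KE.
  by rewrite le_eqVlt; apply/orP; left; apply/eqP; apply: eq_integral => x _; rewrite gap2E.
exists v => [K|]; first by case: (hv K).
rewrite -sumEFin big_seq [leRHS]big_seq; apply: lee_sum => K Km.
by case: (hv K) => _; apply.
Qed.

(** Removes a truncation by monotone convergence: |min(x, n) - min(y, n)| is nondecreasing in n and
    equals |x - y| for large n. *)
Lemma integral_gap2_le (D : set (Rdd R d * Rdd R d)) f (b : \bar R) :
  measurable D -> measurable_fun setT f -> (forall x, 0 <= f x) ->
  (forall n : nat, \int[leb4 R d]_(z in D)
     (gap 2 (fun x => Num.min (f x) n%:R) z)%:E <= b)%E ->
  (\int[leb4 R d]_(z in D) (gap 2 f z)%:E <= b)%E.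
Proof.
move=> mD mf f0 hn.
pose g n z := (gap 2 (fun x => Num.min (f x) n%:R) z)%:E.
have gmono z (n k : nat) : (n <= k)%N -> (g n z <= g k z)%E.
  rewrite -(ler_nat R) => nk; rewrite lee_fin !gap2E.
  set x := f z.1; set y := f z.2; set N := n%:R; set K := k%:R in nk *.
  have aux (s t : R) : s <= t -> 0 <= Num.min t N - Num.min s N <=
      Num.min t K - Num.min s K.
    move=> st; case: (leP t N); case: (leP s N); case: (leP t K); case: (leP s K); lra.
  case: (leP x y) => [xy|/ltW yx].
    have := aux _ _ xy; nra.
  have := aux _ _ yx; nra.
have glim z : limn (g ^~ z) = (gap 2 f z)%:E.
  apply/cvg_lim => //; apply: cvg_near_cst.
  have [n hx] : exists n : nat, f z.1 <= n%:R /\ f z.2 <= n%:R.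
    exists (maxn (Num.truncn (f z.1)).+1 (Num.truncn (f z.2)).+1); split.
      by rewrite (le_trans (ltW (truncnS_gt _)))// ler_nat leq_maxl.
    by rewrite (le_trans (ltW (truncnS_gt _)))// ler_nat leq_maxr.
  exists n => // k /= nk; rewrite /g /gap.
  have nk' : n%:R <= k%:R :> R by rewrite ler_nat.
  by rewrite !(min_idPl _)//; case: hx => *; rewrite (le_trans _ nk').
have mg n : measurable_fun D (g n).
  apply: measurable_funTS; apply: measurable_EFin_gap.
  by apply: measurable_minr => //.
rewrite (_ : (\int[_]_(z in D) _)%E = (\int[leb4 R d]_(z in D) limn (g ^~ z))%E); last first.
  by apply: eq_integral => z _; rewrite glim.
rewrite monotone_convergence//; last 2 first.
- by move=> n z _; rewrite lee_fin gap_ge0.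
- by move=> z _ n k; exact: gmono.
apply: lime_le; last by apply: nearW => n; exact: hn.
apply: ereal_nondecreasing_is_cvgn => n k nk; apply: ge0_le_integral_nomeas.
  by move=> z _; rewrite lee_fin gap_ge0.
by move=> z _; exact: gmono.
Qed.

End cube_values.

Section dyadic_approximation.
Context {R : realType} {d : nat}.
Local Notation idx := (@idx d).
Local Notation cube := (@cube R d).
Local Notation vol := (@vol R d).

Definition dyadic_partition (m : {fset set (Rdd R d)}) : Prop :=
  [/\ partitions None m,
      forall K, K \in m -> measurable K /\ K `<=` unit_cube2,
      forall K K' z, K \in m -> K' \in m -> K z -> K' z -> K = K' &
      forall z, unit_cube2 z -> exists2 K, K \in m & K z].

(** [S] stands for a bound on the semi-norm and [eta] for the price of a piece; one constant [C]
    controls both the number of pieces and the squared error. *)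
Definition approximable (sigma C eta S : R) (f : Rdd R d -> R) : Prop :=
  let N := (S ^+ 2 / eta) `^ (d%:R / (d%:R + sigma)) in
  exists (m : {fset set (Rdd R d)}) (v : set (Rdd R d) -> R),
  [/\ dyadic_partition m, forall K, 0 <= v K, #|` m|%:R <= C * (1 + N) &
      (\sum_(K <- m) \int[leb2 R d]_(x in K) ((f x - v K) ^+ 2)%:E <=
       (C * eta * (1 + N))%:E)%E].

Lemma exists_dyadic_partition (E : forall j, {pred idx j}) (J : nat) : (0 < d)%N ->
  exists m : {fset set (Rdd R d)},
  [/\ dyadic_partition m,
      (#|` m| <= 1 + \sum_(j < J) #|E j| * 2 ^ (2 * d))%N &
      (forall K, K \in m -> exists j (c : idx j),
         K = cube c /\ (c \in E j -> j = J) /\ (j <= J)%N)].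
Proof.
move=> d0; have [m [pm cm lm dm um]] := @exists_partition R d E J d0.
exists m; split=> //; last first.
  by move=> K /lm[j [c [KE jJ cE]]]; exists j, c.
split=> //.
  (* [partitions None] asks for a bound of at least 1 on the number of steps, hence [J.+1]. *)
  by exists J.+1 => //; exists J.
move=> K /lm[j [c [-> _ _]]]; split; first exact: @measurable_cube.
exact: cube_sub.
Qed.

(** Below the threshold [zeta] the square is at most zeta^2; above it, t^2 = t^(2-p) t^p with 2 - p
    <= 0. It passes from p-th powers to squares when p >= 2, with a threshold still to be chosen. *)
Lemma sqr_le_gap (p zeta : R) f (z : Rdd R d * Rdd R d) : 2 <= p -> 0 < zeta ->
  gap 2 f z <= zeta ^+ 2 + zeta `^ (2 - p) * gap p f z.
Proof.
move=> p2 z0; rewrite /gap; set t := `|_|; have t0 : 0 <= t by exact: normr_ge0.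
rewrite powR_mulrn//; have [tz|zt] := leP t zeta.
  by rewrite -[leLHS]addr0 lerD ?lerXn2r ?nnegrE ?(ltW z0)// mulr_ge0 ?powR_ge0.
have t1 : 0 < t by exact: lt_trans zt.
rewrite -[leLHS]add0r lerD ?sqr_ge0//.
have -> : t ^+ 2 = t `^ (2 - p) * t `^ p.
  by rewrite -powRD ?subrK ?powR_mulrn// gt_eqF ?implybT.
rewrite ler_wpM2r ?powR_ge0//.
rewrite -opprB !powRN lef_pV2 ?posrE ?powR_gt0//.
by apply: ge0_ler_powR; rewrite ?nnegrE ?subr_ge0// ltW.
Qed.

Lemma uniform_approximation (p sigma : R) : (0 < d)%N -> 2 <= p -> 0 < sigma ->
  exists2 C : R, 0 < C &
  forall (f : Rdd R d -> R) (eta S : R), measurable_fun setT f ->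
    (forall x, 0 <= f x) -> 0 < eta -> 0 <= S ->
    (forall t, 0 < t -> (modulus p f t <= (S * t `^ sigma)%:E)%E) ->
  approximable sigma C eta S f.
Proof.
move=> d0 p2 s0; pose b : R := 2 ^+ (2 * d).
have b1 : 1 < b by rewrite exprn_egt1 ?ltr1n// muln_eq0 -lt0n.
have b0 : 0 < b by lra.
have d0' : 0 < d%:R :> R by rewrite ltr0n.
pose D := Num.sqrt (2 * d%:R : R).
have D0 : 0 < D by rewrite sqrtr_gt0 mulr_gt0.
pose c2 := (D `^ sigma) `^ p.
have c20 : 0 <= c2 by exact: powR_ge0.
pose C := 2 * b ^+ 2 + b ^+ 2 * c2.
have C0 : 0 < C by rewrite ltr_wpDr ?mulr_ge0 ?mulr_gt0 ?exprn_ge0 ?exprn_gt0 ?(ltW b0).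
exists C => // f eta S mf f0 eta0 S0 hS; rewrite /approximable.
set e := d%:R / (d%:R + sigma); set N := _ `^ e.
have ds : 0 < d%:R + sigma by rewrite addr_gt0.
have e0 : 0 < e by rewrite divr_gt0.
have N0 : 0 <= N by exact: powR_ge0.
(* The least level with at least [N] cubes; minimality gives the upper bound. *)
have [J NJ Jb] : exists2 J : nat, N <= b ^+ J & b ^+ J <= b * (1 + N).
  have ex : exists J, N <= b ^+ J.
    exists (Num.truncn N).+1; apply: (le_trans (ltW (truncnS_gt N))).
    rewrite (@le_trans _ _ (2 ^+ (Num.truncn N).+1))//.
      by rewrite -natrX ler_nat ltnW// ltn_expl.
    by rewrite lerXn2r ?nnegrE ?(ltW b0)// /b -natrX ler_nat
      -[X in (X <= _)%N]expn1 leq_exp2l// muln_gt0.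
  case: (ex_minnP ex) => -[|J] NJ min; first by exists 0%N => //; rewrite expr0; nra.
  exists J.+1 => //; have : b ^+ J < N.
    by rewrite ltNge; apply/negP => /min; rewrite ltnn.
  by rewrite exprS; nra.
have bJ0 : 0 < b ^+ J by rewrite exprn_gt0.
(* Every cube is divided at each step, so the pieces are the cubes of level [J]. *)
have [m [dm cm lm]] := exists_dyadic_partition (fun j => predT : {pred idx j}) J d0.
have lmJ K : K \in m -> exists c : idx J, K = cube c.
  by move=> /lm[j [c [-> [/(_ isT) jJ _]]]]; subst j; exists c.
have cm' : #|` m|%:R <= 1 + b * b ^+ J.
  rewrite (@le_trans _ _ (1 + \sum_(j < J) b ^+ j * b))//.
    move: cm; rewrite -(ler_nat R) => /le_trans; apply.
    rewrite natrD natr_sum lerD2l; apply: ler_sum => j _.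
    by rewrite natrM natrX ler_wpM2r ?(ltW b0)// (card_idx (d := d)) !natrX /b -!exprM mulnC.
  rewrite lerD2l -mulr_suml mulrC ler_wpM2l ?(ltW b0)//.
  have b4 : 2 <= b by rewrite /b -natrX ler_nat -[X in (X <= _)%N]expn1 leq_exp2l// muln_gt0.
  elim: (J) => [|i IH]; first by rewrite big_ord0 expr0.
  rewrite big_ord_recr /= exprS.
  have : 0 < b ^+ i by rewrite exprn_gt0.
  by nra.
have cm2 : #|` m|%:R <= 2 * b ^+ 2 * (1 + N).
  by apply: (le_trans cm'); rewrite expr2; nra.
(* With this threshold zeta^2 times the volume of a cube is [eta], so the first term of [sqr_le_gap]
   costs [eta] per piece; the second, summed over the pieces, is also of order zeta^2 = eta b^J. *)
pose zeta := Num.sqrt (eta * b ^+ J).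
have ebJ : 0 < eta * b ^+ J by rewrite mulr_gt0.
have z0 : 0 < zeta by rewrite sqrtr_gt0.
have z2 : zeta ^+ 2 = eta * b ^+ J by rewrite sqr_sqrtr// ltW.
pose h : R := 2 ^- J.
have h0 : 0 < h by rewrite invr_gt0 exprn_gt0.
(* This is N <= b^J in another form: raised to the power (d + sigma)/d it reads S^2 / eta <= 2^(J
   (2d + 2 sigma)). *)
have Sh : S * h `^ sigma <= zeta.
  rewrite -ler_sqr ?nnegrE ?mulr_ge0 ?powR_ge0 ?(ltW z0)// z2 exprMn.
  have S2 : S ^+ 2 / eta = N `^ e^-1.
    by rewrite -powRrM divff ?gt_eqF// powRr1// divr_ge0 ?sqr_ge0// ltW.
  have : S ^+ 2 / eta <= (b ^+ J) `^ e^-1.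
    by rewrite S2; apply: ge0_ler_powR; rewrite ?nnegrE ?invr_ge0// ltW.
  pose x : R := 2 ^+ J; have x0 : 0 < x by rewrite exprn_gt0.
  have -> : h `^ sigma = x `^ (- sigma) by exact: invr_powR (ltW x0).
  have bE : b ^+ J = x `^ (2 * d%:R).
    by rewrite -natrM powR_mulrn ?(ltW x0)// /b /x -!exprM mulnC.
  rewrite bE -powRrM (powR_exprn 2 _ (ltW x0)).
  have -> : 2 * d%:R * e^-1 = 2 * d%:R + sigma * 2.
    by rewrite /e; field; rewrite !gt_eqF.
  rewrite powRD ?(gt_eqF x0) ?implybT// mulNr powRN ler_pdivrMr// => hS2.
  by rewrite ler_pdivrMr ?powR_gt0// -mulrA mulrC.
have vol0 : 0 < vol J by exact: @vol_gt0.
have volE : vol J = (b ^+ J)^-1 by rewrite vol_exprE.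
have nd : (\int[leb4 R d]_(z in near_diag h) (gap p f z)%:E <=
    (b * vol J * (c2 * zeta `^ p))%:E)%E.
  apply: le_trans (near_diag_energy_le _ (ltW h0) mf) _; first by lra.
  rewrite EFinM; apply: lee_pmul => //; rewrite ?lee_fin ?exprn_ge0 ?mulr_ge0 ?poweR_ge0//.
  - by rewrite ltW.
  - by rewrite exprMn; exact: lexx.
  rewrite (@le_trans _ _ ((S * (D * h) `^ sigma)%:E `^ p)%E)//.
    apply: gt0_ler_poweR; rewrite ?in_itv/= ?leey ?andbT ?lee_fin ?mulr_ge0
      ?powR_ge0//; first by lra.
      by apply: modulus_ge0; rewrite mulr_ge0 ?ltW.
    by apply: hS; rewrite mulr_gt0.
  rewrite poweR_EFin lee_fin [(D * h) `^ _]powRM ?(ltW D0) ?(ltW h0)// mulrCA.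
  rewrite powRM ?powR_ge0// ?mulr_ge0 ?powR_ge0//.
  by rewrite ler_wpM2l//; apply: ge0_ler_powR; rewrite ?nnegrE ?mulr_ge0 ?powR_ge0 ?(ltW z0)//; lra.
pose I K : \bar R := (\int[leb4 R d]_(z in K `*` K) (gap p f z)%:E)%E.
have I0 K : (0 <= I K)%E by apply: integral_ge0 => z _; rewrite lee_fin gap_ge0.
have mgap := measurable_EFin_gap p mf.
have sumI : (\sum_(K <- m) I K <= (b * vol J * (c2 * zeta `^ p))%:E)%E.
  apply: le_trans nd; apply: sum_integral_disjoint_le => //.
  - exact: measurable_near_diag.
  - exact: measurable_funTS.
  - by move=> z _; rewrite lee_fin gap_ge0.
  - by move=> K /lmJ[c ->]; exact: measurable_cube2.
  - by move=> K /lmJ[c ->]; exact: cube_near_diag.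
  - move=> K K' [x y] Km K'm /= [Kx _] [K'x _].
    by case: dm => _ _ dis _; exact: dis Kx K'x.
have Ifin K : K \in m -> I K \is a fin_num.
  move=> Km; rewrite ge0_fin_numE//; apply: le_lt_trans (ltry (b * vol J * (c2 * zeta `^ p))).
  apply: le_trans sumI; rewrite (big_fsetD1 K)//= leeDl// sume_ge0//.
pose B K := zeta ^+ 2 * vol J + zeta `^ (2 - p) * fine (I K) / vol J.
have B0 K : 0 <= B K.
  by rewrite addr_ge0// ?mulr_ge0 ?invr_ge0 ?fine_ge0 ?sqr_ge0 ?powR_ge0// ltW.
have [K Km|v v0 hv] := exists_step_values mf f0 B0 (m := m).
  have [c KE] := lmJ K Km; exists J, c; split=> //.
  have mK : measurable (K `*` K) by rewrite KE; exact: measurable_cube2.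
  apply: (@le_trans _ _ (\int[leb4 R d]_(z in K `*` K)
     ((zeta ^+ 2)%:E + (zeta `^ (2 - p))%:E * (gap p f z)%:E))%E).
    apply: ge0_le_integral_nomeas => z _; first by rewrite lee_fin gap_ge0.
    by rewrite -EFinM -EFinD lee_fin sqr_le_gap.
  rewrite ge0_integralD//; last 3 first.
  - by move=> z _; rewrite lee_fin sqr_ge0.
  - by move=> z _; rewrite -EFinM lee_fin mulr_ge0 ?powR_ge0.
  - by apply: measurable_funTS; apply: measurable_funeM.
  rewrite integral_cst// ge0_integralZl//; last 3 first.
  - exact: measurable_funTS.
  - by move=> z _; rewrite lee_fin gap_ge0.
  - by rewrite lee_fin powR_ge0.
  rewrite -/(I K) -(fineK (Ifin K Km)).
  have mm : leb4 R d (K `*` K) = (vol J * vol J)%:E by rewrite KE leb4_cube2.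
  rewrite [X in (_ * X + _)%E]mm.
  rewrite -!EFinM -EFinD lee_fin /B mulrDl divfK ?gt_eqF//.
  by rewrite mulrA.
exists m, v; split=> //.
  apply: (le_trans cm2); rewrite ler_wpM2r ?addr_ge0// /C lerDl.
  by rewrite mulr_ge0// exprn_ge0// ltW.
apply: (le_trans hv); rewrite lee_fin.
have -> : \sum_(K <- m) B K = zeta ^+ 2 * vol J * #|` m|%:R +
    zeta `^ (2 - p) * (\sum_(K <- m) fine (I K)) / vol J.
  rewrite big_split /= big_const_seq count_predT iter_addr_0.
  by rewrite mulr_sumr mulr_suml mulr_natr.
have sumI' : \sum_(K <- m) fine (I K) <= b * vol J * (c2 * zeta `^ p).
  rewrite -lee_fin -sumEFin; apply: le_trans sumI.
  rewrite big_seq [leRHS]big_seq; apply: lee_sum => K Km.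
  by rewrite fineK// Ifin.
rewrite z2 [in X in X + _]volE mulfK ?gt_eqF//.
have step : zeta `^ (2 - p) * (\sum_(K <- m) fine (I K)) / vol J <=
    eta * b ^+ J * (b * c2).
  rewrite ler_pdivrMr// (le_trans (ler_wpM2l (powR_ge0 _ _) sumI'))//.
  have e2 : zeta ^+ 2 = zeta `^ (2 - p) * zeta `^ p.
    by rewrite -powRD ?subrK ?powR_mulrn ?(ltW z0)// gt_eqF ?implybT.
  rewrite -z2 e2.
  by rewrite le_eqVlt; apply/orP; left; apply/eqP; ring.
apply: (le_trans (lerD (ler_wpM2l (ltW eta0) cm2) step)).
have : eta * (b * c2) * b ^+ J <= eta * (b * c2) * (b * (1 + N)).
  by rewrite ler_wpM2l// mulr_ge0// ?mulr_ge0// ltW.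
by rewrite /C expr2; lra.
Qed.

End dyadic_approximation.

(** * Adaptive approximation: p < 2 *)

Section besov_energy.
Context {R : realType} {d : nat}.
Local Notation idx := (@idx d).
Local Notation cube := (@cube R d).
Local Notation vol := (@vol R d).

Lemma nneseries_le (u : nat -> \bar R) (b : \bar R) :
  (forall i, 0 <= u i)%E -> (forall n, \sum_(i < n) u i <= b)%E ->
  (\sum_(i <oo) u i <= b)%E.
Proof.
move=> u0 ub; apply: lime_le; first by apply: is_cvg_nneseries => *; exact: u0.
by apply: nearW => n; rewrite big_mkord.
Qed.

Lemma modulus_homo p (f : Rdd R d -> R) (s t : R) : s <= t ->
  (modulus p f s <= modulus p f t)%E.
Proof.
by move=> st; apply: le_ereal_sup => _ [u us <-]; exists u => //=; exact: le_trans st.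
Qed.

(* The integrand of the Besov semi-norm is bounded below by a constant on each
   of the disjoint intervals [[h_i, 2 h_i)], [h_i = D 2^-i]. *)
Lemma sum_modulus_le (p sigma D : R) (f : Rdd R d -> R) : 0 < p -> 0 < sigma ->
  0 < D ->
  (\sum_(i <oo) ((2 `^ (sigma * p)) ^+ i)%:E * modulus p f (D * 2 ^- i) `^ p <=
   (2 * (2 * D) `^ (sigma * p))%:E *
   \int[lebesgue_measure]_(t in `]0%R, +oo[%classic)
     (((t `^ (- sigma))%:E * modulus p f t) `^ p * (t^-1)%:E))%E.
Proof.
move=> p0 s0 D0; pose h i : R := D * 2 ^- i.
have h0 i : 0 < h i by rewrite mulr_gt0// invr_gt0 exprn_gt0.
have h2 i : 0 < 2 * h i by rewrite mulr_gt0.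
have hS i k : (i < k)%N -> 2 * h k <= h i.
  move=> ik; have e : 2 ^+ i * 2 <= 2 ^+ k :> R.
    by rewrite -exprSr ler_eXn2l// ltr1n.
  have : 2 ^- k <= (2 ^+ i * 2)^-1 :> R.
    by rewrite lef_pV2// posrE ?mulr_gt0 ?exprn_gt0.
  by rewrite invfM /h => e'; nra.
pose J i : set R := `[h i, 2 * h i[%classic.
pose M i := modulus p f (h i).
have M0 i : (0 <= M i)%E by apply: modulus_ge0; exact: ltW.
pose g i := ((((2 * h i) `^ (- sigma))%:E * M i) `^ p * ((2 * h i)^-1)%:E)%E.
have g0 i : (0 <= g i)%E.
  by rewrite mule_ge0 ?poweR_ge0// lee_fin invr_ge0 ltW.
set F := (fun t : R => _ * _)%E.
have gF i t : J i t -> (g i <= F t)%E.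
  rewrite /J /= in_itv/= => /andP[ht th].
  have t0 : 0 < t by exact: lt_le_trans ht.
  apply: lee_pmul; rewrite ?poweR_ge0// ?lee_fin ?invr_ge0 ?(ltW (h2 i))//.
    apply: gt0_ler_poweR; rewrite ?in_itv/= ?leey ?andbT ?mule_ge0 ?lee_fin ?powR_ge0 ?(ltW p0)//.
      by apply: modulus_ge0; exact: ltW.
    apply: lee_pmul; rewrite ?lee_fin ?powR_ge0//; last exact: modulus_homo.
    rewrite !powRN lef_pV2 ?posrE ?powR_gt0//.
    by apply: ge0_ler_powR; rewrite ?nnegrE ?(ltW s0) ?(ltW t0) ?(ltW (h2 i)) ?(ltW th).
  by rewrite lef_pV2 ?posrE// ltW.
have termE i : (((2 `^ (sigma * p)) ^+ i)%:E * M i `^ p =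
    (2 * (2 * D) `^ (sigma * p))%:E * (g i * (h i)%:E))%E.
  rewrite /g poweRM ?lee_fin ?powR_ge0// poweR_EFin.
  have -> : ((((2 * h i) `^ (- sigma)) `^ p)%:E * M i `^ p * ((2 * h i)^-1)%:E * (h i)%:E =
     (((2 * h i) `^ (- sigma)) `^ p / 2)%:E * M i `^ p)%E.
    rewrite -!muleA [(M i `^ p * _)%E]muleC !muleA -!EFinM; congr ((_)%:E * _)%E.
    by rewrite -mulrA invfM -mulrA mulVf ?mulr1// gt_eqF.
  rewrite muleA -EFinM; congr ((_)%:E * _)%E.
  have hE : (2 * h i) `^ (- sigma * p) = ((2 * D) `^ (sigma * p))^-1 * (2 `^ (sigma * p)) ^+ i.
    rewrite /h mulrA (@powRM _ (2 * D)) ?mulr_ge0 ?invr_ge0 ?exprn_ge0 ?(ltW D0)//.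
    rewrite !mulNr powRN; congr (_ * _).
    rewrite -powR_invn// -powRrM mulrNN -[RHS]powR_mulrn ?powR_ge0// -powRrM.
    by rewrite mulrC.
  rewrite -powRrM hE; field; rewrite gt_eqF// powR_gt0// mulr_gt0//.
apply: nneseries_le => [i|n]; first by rewrite mule_ge0 ?poweR_ge0// lee_fin exprn_ge0 ?powR_ge0.
rewrite (eq_bigr _ (fun (i : 'I_n) _ => termE i)).
rewrite -ge0_sume_distrr; last by move=> i _; rewrite mule_ge0 ?lee_fin ?(ltW (h0 i)).
apply: lee_wpmul2l; first by rewrite lee_fin mulr_ge0 ?powR_ge0.
have mJ i : measurable (J i : set (measurableTypeR R)) by exact: measurable_itv.
have gh (i : 'I_n) : (g i * (h i)%:E = \int[lebesgue_measure]_(t in `]0%R, +oo[%classic)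
     (g i * (\1_(J i) t)%:E))%E.
  rewrite ge0_integralZl//; last by apply/measurable_EFinP; exact: measurable_indic (mJ i).
  rewrite integral_indic//.
  rewrite setIidl; last first.
    move=> t; rewrite /J /= !in_itv/= andbT => /andP[ht _]; exact: lt_le_trans ht.
  suff hJ : lebesgue_measure (J i) = (h i)%:E by congr (_ * _)%E; rewrite -hJ.
  rewrite lebesgue_measure_itv/= lte_fin ifT; last by have := h0 i; lra.
  by rewrite -EFinB; congr EFin; ring.
rewrite (eq_bigr _ (fun i _ => gh i)) -ge0_integral_sum//; first last.
- by move=> i t _; rewrite mule_ge0// lee_fin.
- by move=> i; apply: measurable_funeM; apply/measurable_EFinP; exact: (measurable_indic (mJ i)).
apply: ge0_le_integral_nomeas => t; rewrite /= in_itv/= andbT => t0.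
  by apply: sume_ge0 => i _; rewrite mule_ge0// lee_fin.
(* The intervals are disjoint by [hS], so at most one indicator is nonzero at t. *)
have [[i Jt]|nJ] := pselect (exists i : 'I_n, J i t).
  rewrite (bigD1 i)//= big1 ?adde0 => [|k ki].
    by rewrite indicE mem_set// mule1; exact: gF Jt.
  rewrite indicE memNset ?mule0// => Jkt; move: Jt Jkt.
  rewrite /J /= !in_itv/= => /andP[i1 i2] /andP[k1 k2].
  move: ki; rewrite -val_eqE/= neq_ltn => /orP[] /hS; lra.
rewrite big1 => [|i _]; last by rewrite indicE memNset ?mule0// => Jt; apply: nJ; exists i.
by rewrite mule_ge0 ?poweR_ge0// lee_fin invr_ge0 ltW.
Qed.

(** In the weight (b Q)^i, b^i compensates the volume of the displacements of size 2^-i and Q^i is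
    the weight of the Besov sum, so that [sum_modulus_le] bounds the integral of [W].
    Superadditivity holds because all the [a j c] integrate the same [W], over squares of disjoint
    cubes; on a cube of level j the single term i = j of [W] gives the last bound. *)
Lemma besov_energy (p sigma : R) : (0 < d)%N -> 0 < p -> 0 < sigma ->
  exists2 C : R, 0 < C &
  forall (f : Rdd R d -> R) (S : R), measurable_fun setT f -> 0 <= S ->
    (besov_seminorm sigma p%:E p f <= S%:E)%E ->
  exists a : forall j, idx j -> R,
  [/\ forall j c, 0 <= a j c,
      forall j c, \sum_(c' : idx j.+1 | parent c' == c) a j.+1 c' <= a j c,
      forall j, \sum_(c : idx j) a j c <= C * S `^ p &
      forall j c, (\int[leb4 R d]_(z in cube c `*` cube c) (gap p f z)%:E <=
        ((2 `^ (- (sigma * p))) ^+ j * a j c * vol j)%:E)%E].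
Proof.
move=> d0 p0 s0.
pose b : R := 2 ^+ (2 * d); pose Q : R := 2 `^ (sigma * p).
have b0 : 0 < b by rewrite exprn_gt0.
have Q0 : 0 < Q by exact: powR_gt0.
pose D := Num.sqrt (2 * d%:R : R).
have D0 : 0 < D by rewrite sqrtr_gt0 mulr_gt0// ltr0n.
pose C1 : R := 2 * (2 * D) `^ (sigma * p).
have C10 : 0 < C1 by rewrite mulr_gt0// powR_gt0// mulr_gt0.
exists (b * C1); first exact: mulr_gt0.
move=> f S mf S0 hS.
set I := (\int[lebesgue_measure]_(t in `]0%R, +oo[%classic)
     (((t `^ (- sigma))%:E * modulus p f t) `^ p * (t^-1)%:E))%E.
have I0 : (0 <= I)%E.
  apply: integral_ge0 => t; rewrite /= in_itv/= andbT => t0.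
  by rewrite mule_ge0 ?poweR_ge0// lee_fin invr_ge0 ltW.
have IS : (I <= (S `^ p)%:E)%E.
  have -> : I = ((I `^ p^-1) `^ p)%E by rewrite -poweRrM mulVf ?gt_eqF// poweRe1.
  rewrite -poweR_EFin; apply: gt0_ler_poweR; rewrite ?in_itv/= ?leey ?andbT ?poweR_ge0 ?(ltW p0)//.
have mg := measurable_EFin_gap p mf.
pose k i (z : Rdd R d * Rdd R d) : \bar R :=
  (((b * Q) ^+ i)%:E * ((\1_(near_diag (2 ^- i)) z)%:E * (gap p f z)%:E))%E.
have k0 i z : (0 <= k i z)%E.
  by rewrite /k -!EFinM lee_fin !mulr_ge0 ?gap_ge0// exprn_ge0// mulr_ge0// ltW.
have mk i : measurable_fun setT (k i).
  apply: measurable_funeM; apply: emeasurable_funM => //.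
  by apply/measurable_EFinP; apply: measurable_indic; exact: measurable_near_diag.
pose W z := (\sum_(i <oo) k i z)%E.
have W0 z : (0 <= W z)%E by apply: nneseries_ge0 => *; exact: k0.
have mW : measurable_fun setT W.
  by apply: ge0_emeasurable_sum => // i z _ _; exact: k0.
have intk i : (\int[leb4 R d]_z k i z = ((b * Q) ^+ i)%:E *
    \int[leb4 R d]_(z in near_diag (2 ^- i)) (gap p f z)%:E)%E.
  rewrite ge0_integralZl//; last 3 first.
  - apply: emeasurable_funM => //; apply/measurable_EFinP; apply: measurable_indic.
    exact: measurable_near_diag.
  - by move=> z _; rewrite -EFinM lee_fin mulr_ge0// gap_ge0.
  - by rewrite lee_fin exprn_ge0// mulr_ge0// ltW.
  congr (_ * _)%E; rewrite [RHS]integral_mkcond; apply: eq_integral => z _.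
  by rewrite patchE indicE; case: ifPn => _; rewrite ?mul1e ?mul0e.
have intW : (\int[leb4 R d]_z W z <= (b * C1 * S `^ p)%:E)%E.
  rewrite integral_nneseries//.
  apply: (@le_trans _ _ (\sum_(i <oo) (b%:E * ((Q ^+ i)%:E * modulus p f (D * 2 ^- i) `^ p)))%E).
    apply: lee_nneseries => [i _ _|i _]; first by apply: integral_ge0.
    rewrite intk; have h0 : 0 <= 2 ^- i :> R by rewrite invr_ge0 exprn_ge0.
    apply: (@le_trans _ _ _ _ _ (lee_wpmul2l _ (near_diag_energy_le p0 h0 mf))).
      by rewrite lee_fin exprn_ge0// mulr_ge0// ltW.
    have e : (b * Q) ^+ i * (2 * 2 ^- i) ^+ (2 * d) = b * Q ^+ i.
      rewrite !exprMn -/b exprVn -[(2 ^+ i) ^+ _]exprM [(i * _)%N]mulnC exprM -/b.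
      by field; rewrite gt_eqF// exprn_gt0.
    by rewrite !muleA -!EFinM e.
  rewrite nneseriesZl ?lee_fin ?(ltW b0)//; last first.
    by move=> i _; rewrite mule_ge0 ?poweR_ge0// lee_fin exprn_ge0// ltW.
  rewrite -(mulrA b C1) (EFinM b); apply: lee_wpmul2l; first by rewrite lee_fin ltW.
  apply: le_trans (sum_modulus_le f p0 s0 D0) _.
  by rewrite (EFinM C1); apply: lee_wpmul2l => //; rewrite lee_fin ltW.
pose aE j (c : idx j) := (\int[leb4 R d]_(z in cube c `*` cube c) W z)%E.
have aE0 j c : (0 <= @aE j c)%E by apply: integral_ge0.
have aEfin j c : @aE j c \is a fin_num.
  rewrite ge0_fin_numE//; apply: le_lt_trans (ltry (b * C1 * S `^ p)).
  apply: le_trans intW; apply: ge0_subset_integral => //; exact: measurable_cube2.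
have uniq_cell j (c c' : idx j) (z : Rdd R d) : cube c z -> cube c' z -> c = c'.
  by move=> /cubeE[_ <-] /cubeE[_ <-].
exists (fun j c => fine (aE j c)); split.
- by move=> j c; apply: fine_ge0.
- move=> j c; rewrite -lee_fin -sumEFin fineK//.
  under eq_bigr do rewrite fineK//.
  rewrite -big_filter /aE; apply: sum_integral_disjoint_le => //.
  + exact: measurable_cube2.
  + exact: measurable_funTS.
  + by rewrite filter_uniq// index_enum_uniq.
  + by move=> c' _; exact: measurable_cube2.
  + move=> c'; rewrite mem_filter => /andP[/eqP <- _] z [/= z1 z2].
    by split; exact: cube_parent.
  + by move=> c1 c2 z _ _ [z1 _] [z2 _]; exact: uniq_cell z1 z2.
- move=> j; rewrite -lee_fin -sumEFin; under eq_bigr do rewrite fineK//.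
  apply: le_trans intW; rewrite /aE; apply: sum_integral_disjoint_le => //.
  + exact: index_enum_uniq.
  + by move=> c' _; exact: measurable_cube2.
  + by move=> c1 c2 z _ _ [z1 _] [z2 _]; exact: uniq_cell z1 z2.
- move=> j c; have bQ0 : 0 < (b * Q) ^+ j by rewrite exprn_gt0// mulr_gt0.
  have -> : (2 `^ (- (sigma * p))) ^+ j * fine (aE j c) * vol j =
      ((b * Q) ^+ j)^-1 * fine (aE j c).
    rewrite vol_exprE -/b powRN -/Q exprMn exprVn; field.
    by rewrite !gt_eqF// exprn_gt0.
  rewrite EFinM fineK// lee_pdivlMl// -ge0_integralZl//; last 4 first.
  + exact: measurable_cube2.
  + exact: measurable_funTS.
  + by move=> z _; rewrite lee_fin gap_ge0.
  + by rewrite lee_fin ltW.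
  apply: ge0_le_integral_nomeas => z cz.
    by rewrite -EFinM lee_fin mulr_ge0 ?gap_ge0// ltW.
  apply: (@le_trans _ _ (\sum_(0 <= i < j.+1) k i z)%E); last first.
    by apply: nneseries_lim_ge => *; exact: k0.
  rewrite big_nat_recr//=; apply: le_trans (leeDr _ _); last first.
    by apply: sume_ge0 => i _; exact: k0.
  by rewrite /k indicE mem_set ?mul1e//; exact: cube_near_diag cz.
Qed.

End besov_energy.

(** * Poincare inequality on dyadic cubes *)

Section poincare.
Context {R : realType} {d : nat}.
Local Notation idx := (@idx d).
Local Notation cube := (@cube R d).
Local Notation vol := (@vol R d).

Lemma powR_dist_le (p x y z : R) : 0 < p ->
  `|x - z| `^ p <= 2 `^ p * (`|y - x| `^ p + `|y - z| `^ p).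
Proof.
move=> p0; have mono s t : 0 <= s -> s <= t -> s `^ p <= t `^ p.
  by move=> s0 st; apply: ge0_ler_powR; rewrite ?nnegrE ?(ltW p0)// (le_trans s0).
have tri : `|x - z| <= `|y - x| + `|y - z|.
  by rewrite (distrC y x) (le_trans _ (ler_normD _ _))//= addrA subrK.
have u0 : 0 <= `|y - x| by exact: normr_ge0.
have v0 : 0 <= `|y - z| by exact: normr_ge0.
have [uv|vu] := leP `|y - x| `|y - z|.
  apply: (@le_trans _ _ ((2 * `|y - z|) `^ p)); first by apply: mono => //; lra.
  by rewrite powRM// ler_wpM2l ?powR_ge0// lerDr powR_ge0.
apply: (@le_trans _ _ ((2 * `|y - x|) `^ p)); first by apply: mono => //; lra.
by rewrite powRM// ler_wpM2l ?powR_ge0// lerDl powR_ge0.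
Qed.

(** A weighted Young inequality. The usual factor 2 in front of the first term could destroy the
    contraction in the recursion, which needs (1 + eps) r < 1 with r possibly close to 1. *)
Lemma sqr_dist_le (eps x y z : R) : 0 < eps ->
  (x - z) ^+ 2 <= (1 + eps) * (x - y) ^+ 2 + (1 + eps^-1) * (y - z) ^+ 2.
Proof.
move=> e0; set u := x - y; set v := y - z.
have -> : x - z = u + v by rewrite /u /v addrA subrK.
have h : 0 <= eps^-1 * (eps * u - v) ^+ 2 by rewrite mulr_ge0 ?invr_ge0 ?sqr_ge0// ltW.
have : eps^-1 * (eps * u - v) ^+ 2 = eps * u ^+ 2 - 2 * (u * v) + eps^-1 * v ^+ 2.
  by field; rewrite gt_eqF.
by move=> hE; rewrite hE in h; rewrite sqrrD; lra.
Qed.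

(** Supplies the crude bound on the errors; its constant depends on the truncation level [M] and
    enters only the vanishing remainder. *)
Lemma sqr_le_powR (p M t : R) : 0 < p -> p < 2 -> `|t| <= M ->
  t ^+ 2 <= M `^ (2 - p) * `|t| `^ p.
Proof.
move=> p0 p2 tM; have [->|t0] := eqVneq t 0.
  by rewrite expr0n/= mulr_ge0 ?powR_ge0.
have nt0 : 0 < `|t| by rewrite normr_gt0.
have -> : t ^+ 2 = `|t| `^ (2 - p) * `|t| `^ p.
  rewrite -powRD ?subrK ?gt_eqF ?implybT// powR_mulrn ?normr_ge0//.
  by rewrite real_normK ?num_real.
rewrite ler_wpM2r ?powR_ge0//; apply: ge0_ler_powR; rewrite ?nnegrE ?subr_ge0 ?(ltW p2)//.
exact: le_trans tM.
Qed.

(* The error on a cube is at most [1 + eps] times the sum of the errors on its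
   children, plus the cost of changing the constant from the cube to its
   children; [tree_recursion] adds up these costs.  The truncation [g <= M] only
   serves to make the remainder at depth [n] tend to [0]. *)
Lemma truncated_poincare (p q e r b eps C : R) (g : Rdd R d -> R) (M : R)
    (a : forall j, idx j -> R) :
  0 < p -> p < 2 -> 0 < q -> q <= 1 -> b = 2 ^+ (2 * d) -> e = 2 / p ->
  r = q `^ e * b `^ (e - 1) -> 0 < eps ->
  (1 + eps) * q < 1 -> (1 + eps) * r < 1 ->
  C = (1 + eps^-1) * (2 * 2 `^ p * b) `^ e ->
  measurable_fun setT g -> (forall x, 0 <= g x <= M) ->
  (forall j c, 0 <= a j c) ->
  (forall j c, \sum_(c' : idx j.+1 | parent c' == c) a j.+1 c' <= a j c) ->
  (forall j c, (\int[leb4 R d]_(z in cube c `*` cube c) (gap p g z)%:E <=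
     (q ^+ j * a j c * vol j)%:E)%E) ->
  forall j c, (\int[leb4 R d]_(z in cube c `*` cube c) (gap 2 g z)%:E <=
     (4 * (C / (1 - (1 + eps) * r)) * (r ^+ j * a j c `^ e) * vol j)%:E)%E.
Proof.
move=> p0 p2 q0 q1 bE eE rE eps0 eq1 er1 CE mg gM a0 asum aE.
have b0 : 0 < b by rewrite bE exprn_gt0.
have e1 : 1 <= e by rewrite eE ler_pdivlMr// mul1r ltW.
have vb j : vol j = b ^- j by rewrite vol_exprE bE.
have M0 : 0 <= M by have /andP[h1 h2] := gM ([tuple 0 | k < d], [tuple 0 | k < d]);
  exact: le_trans h2.
have qa0 j c : 0 <= q ^+ j * a j c by rewrite mulr_ge0// exprn_ge0// ltW.
have /choice[v' hv'] : forall t : {j : nat & idx j}, exists y,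
    (0 <= y <= M) /\
    (\int[leb2 R d]_(x in cube (projT2 t)) (`|g x - y| `^ p)%:E <=
     (q ^+ (projT1 t) * a _ (projT2 t))%:E)%E.
  move=> [j c] /=; have [y cy hy] := exists_cube_value mg (qa0 j c) (aE j c).
  by exists (g y).
pose v j (c : idx j) := v' (existT _ j c).
have vM j c : 0 <= v j c <= M by have [] := hv' (existT _ j c).
have vp j c : (\int[leb2 R d]_(x in cube c) (`|g x - v j c| `^ p)%:E <=
    (q ^+ j * a j c)%:E)%E by have [] := hv' (existT _ j c).
have mc j (c : idx j) : measurable (cube c) by exact: @measurable_cube.
have mgv y : measurable_fun setT (fun x => g x - y) by exact: measurable_funB.
have mp y : measurable_fun setT (fun x => (`|g x - y| `^ p)%:E).
  apply/measurable_EFinP; apply: (measurableT_comp (measurable_powR p)).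
  exact: (measurableT_comp (@normr_measurable R setT)).
have m2 y : measurable_fun setT (fun x => ((g x - y) ^+ 2)%:E).
  by apply/measurable_EFinP; apply: measurable_funX.
have ip0 y (x : Rdd R d) : (0 <= (`|g x - y| `^ p)%:E)%E by rewrite lee_fin powR_ge0.
have i20 y (x : Rdd R d) : (0 <= ((g x - y) ^+ 2)%:E)%E by rewrite lee_fin sqr_ge0.
pose wE j (c : idx j) := (\int[leb2 R d]_(x in cube c) ((g x - v j c) ^+ 2)%:E)%E.
have wB j c : (@wE j c <= (M `^ (2 - p) * (q ^+ j * a j c))%:E)%E.
  rewrite EFinM; apply: le_trans (lee_wpmul2l _ (vp j c)); last by rewrite lee_fin powR_ge0.
  rewrite -ge0_integralZl//; last 2 first.
  - exact: measurable_funTS.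
  - by rewrite lee_fin powR_ge0.
  apply: ge0_le_integral_nomeas => x _ //; rewrite -EFinM lee_fin sqr_le_powR//.
  have := gM x; have := vM j c; rewrite ler_norml; lra.
have w0 j c : (0 <= @wE j c)%E by apply: integral_ge0.
have wfin j c : @wE j c \is a fin_num.
  by rewrite ge0_fin_numE// (le_lt_trans (wB j c)) ?ltry.
pose w j c := fine (@wE j c).
have child_le j c c' : parent c' = c -> a j.+1 c' <= a j c.
  move=> pc; apply: le_trans (asum j c).
  by rewrite (bigD1 c') ?pc//= lerDl sumr_ge0.
(* The constants of a cube and of its child are compared through [g], integrating the triangle
   inequality over the child. *)
have delta j c c' : parent c' = c ->
    `|v j.+1 c' - v j c| `^ p * vol j.+1 <= 2 * 2 `^ p * (q ^+ j * a j c).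
  move=> pc; rewrite -lee_fin EFinM -(leb2_cube c') -(integral_cst (leb2 R d) (mc _ c')).
  apply: (@le_trans _ _ (\int[leb2 R d]_(x in cube c')
    ((2 `^ p)%:E * ((`|g x - v j.+1 c'| `^ p)%:E + (`|g x - v j c| `^ p)%:E)))%E).
    apply: ge0_le_integral_nomeas => x _; first by rewrite lee_fin powR_ge0.
    by rewrite -EFinD -EFinM lee_fin powR_dist_le.
  rewrite ge0_integralZl//; last 2 first.
  - by apply: measurable_funTS; apply: emeasurable_funD.
  - by move=> x _; rewrite adde_ge0.
  rewrite ge0_integralD//; last 2 first.
  - exact: measurable_funTS.
  - exact: measurable_funTS.
  rewrite [2 * _]mulrC -mulrA EFinM; apply: lee_wpmul2l; first by rewrite lee_fin powR_ge0.
  rewrite mulr2n mulrDl mul1r EFinD; apply: leeD.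
    apply: le_trans (vp j.+1 c') _; rewrite lee_fin.
    rewrite exprS -mulrA; have := qa0 j.+1 c'; rewrite exprS -mulrA => h.
    apply: (@le_trans _ _ (q ^+ j * a j.+1 c')).
      have : 0 <= q ^+ j * a j.+1 c' by rewrite mulr_ge0// exprn_ge0// ltW.
      nra.
    by rewrite ler_wpM2l ?exprn_ge0 ?(ltW q0)// child_le.
  apply: le_trans (vp j c); apply: ge0_subset_integral => //.
    exact: measurable_funTS.
  by rewrite -pc; exact: cube_parent.
(* The power e = 2/p turns p-th powers into squares. The factor r^j is (q b)^(e j) b^(-j), where
   b^(-j) comes from the volume; this is the origin of [r]. *)
have delta2 j c c' : parent c' = c ->
    (v j.+1 c' - v j c) ^+ 2 * vol j.+1 <=
    (2 * 2 `^ p * b) `^ e * (r ^+ j * a j c `^ e) / b.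
  move=> pc; have vol0 : 0 < vol j.+1 by exact: @vol_gt0.
  have dle : `|v j.+1 c' - v j c| `^ p <= 2 * 2 `^ p * b * (q ^+ j * a j c * b ^+ j).
    rewrite -(ler_pM2r vol0); apply: le_trans (delta _ _ _ pc) _.
    rewrite le_eqVlt; apply/orP; left; apply/eqP; rewrite vb exprS; field.
    by rewrite !gt_eqF// exprn_gt0.
  have -> : (v j.+1 c' - v j c) ^+ 2 = (`|v j.+1 c' - v j c| `^ p) `^ e.
    rewrite -powRrM eE mulrC divfK ?gt_eqF// powR_mulrn// real_normK ?num_real//.
  have pw0 : 0 <= 2 `^ p :> R by exact: powR_ge0.
  have : (`|v j.+1 c' - v j c| `^ p) `^ e <=
      (2 * 2 `^ p * b * (q ^+ j * a j c * b ^+ j)) `^ e.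
    apply: ge0_ler_powR; rewrite ?nnegrE ?powR_ge0//; first by lra.
    exact: le_trans dle.
  have qab : 0 <= q ^+ j * a j c * b ^+ j by rewrite mulr_ge0// exprn_ge0// ltW.
  have bj0 : 0 < b ^+ j by rewrite exprn_gt0.
  have bb0 : 0 <= 2 * 2 `^ p * b by rewrite mulr_ge0 ?mulr_ge0// ltW.
  rewrite (powRM e bb0 qab) (powRM e (qa0 j c) (ltW bj0)).
  rewrite (powRM e (exprn_ge0 j (ltW q0)) (a0 j c)) => h.
  apply: le_trans (ler_wpM2r (ltW vol0) h) _.
  rewrite le_eqVlt; apply/orP; left; apply/eqP.
  have powX x (n : nat) : 0 < x -> (x ^+ n) `^ e = (x `^ e) ^+ n.
    by move=> x0; rewrite (exprn_powR _ _ (ltW x0)) (powR_exprn _ _ (ltW x0)) mulrC.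
  rewrite !powX// rE vb exprMn exprS.
  have -> : b `^ (e - 1) = b `^ e / b.
    by rewrite powRB ?powRr1 ?(ltW b0)// (gt_eqF b0) implybT.
  rewrite exprMn exprVn; field.
  by rewrite !gt_eqF// exprn_gt0.
have r0 : 0 <= r by rewrite rE mulr_ge0 ?powR_ge0.
have ei0 : 0 <= 1 + eps^-1 by rewrite addr_ge0// invr_ge0 ltW.
have C0 : 0 <= C by rewrite CE mulr_ge0 ?powR_ge0.
have wC j c : w j c <= (1 + eps) * (\sum_(c' : idx j.+1 | parent c' == c) w j.+1 c') +
    C * (r ^+ j * a j c `^ e).
  rewrite -lee_fin fineK//.
  have step : (@wE j c <= \sum_(c' : idx j.+1 | parent c' == c)
      ((1 + eps) * w j.+1 c' +
       (1 + eps^-1) * ((2 * 2 `^ p * b) `^ e * (r ^+ j * a j c `^ e) / b))%:E)%E.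
    rewrite -big_filter.
    apply: le_trans (@integral_le_sum_cover _ _ _ (leb2 R d) _
      [seq c' <- index_enum (idx j.+1) | parent c' == c] (fun c' => cube c') (cube c)
      _ (mc _ c) (m2 (v j c)) (i20 _) _ _) _ => //.
      move=> x cx; exists (cell j.+1 x); last by apply: cube_cell; exact: cube_sub cx.
      rewrite mem_filter mem_index_enum andbT parent_cell; last exact: cube_sub cx.
      by move/cubeE: cx => [_ ->].
    rewrite big_seq [leRHS]big_seq; apply: lee_sum => c'.
    rewrite mem_filter => /andP[/eqP pc _].
    apply: (@le_trans _ _ (\int[leb2 R d]_(x in cube c')
      ((1 + eps)%:E * ((g x - v j.+1 c') ^+ 2)%:E +
       ((1 + eps^-1) * (v j.+1 c' - v j c) ^+ 2)%:E))%E).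
      apply: ge0_le_integral_nomeas => x _ //.
      by rewrite -EFinM -EFinD lee_fin sqr_dist_le.
    rewrite ge0_integralD//; last 3 first.
    - by move=> x _; rewrite mule_ge0// lee_fin; lra.
    - by apply: measurable_funTS; apply: measurable_funeM.
    - by move=> x _; rewrite lee_fin mulr_ge0 ?sqr_ge0.
    rewrite ge0_integralZl//; last 2 first.
    - exact: measurable_funTS.
    - by rewrite lee_fin; lra.
    rewrite [leRHS]EFinD (EFinM (1 + eps)) fineK//; apply: leeD => //.
    rewrite integral_cst// [X in (_ * X)%E](leb2_cube c') -EFinM lee_fin.
    by rewrite -[leLHS]mulrA ler_wpM2l// delta2.
  apply: le_trans step _.
  rewrite sumEFin lee_fin big_split /= -mulr_sumr lerD2l sumr_const -[leLHS]mulr_natr.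
  (* There are at most [b] children, which cancels the division by [b] in [delta2]. *)
  have cb : #|[pred c' : idx j.+1 | parent c' == c]|%:R <= b.
    rewrite bE -natrX ler_nat.
    by have := card_children (pred1 c); rewrite card1 mul1n.
  rewrite CE; set Y := (_ `^ e * _).
  have Y0 : 0 <= (1 + eps^-1) * (Y / b).
    by rewrite mulr_ge0// mulr_ge0 ?invr_ge0 ?(ltW b0)// /Y !mulr_ge0 ?powR_ge0 ?exprn_ge0.
  apply: le_trans (ler_wpM2l Y0 cb) _.
  have -> : (1 + eps^-1) * (Y / b) * b = (1 + eps^-1) * Y.
    by field; rewrite !gt_eqF.
  by rewrite /Y !mulrA.
have wB' j c : w j c <= M `^ (2 - p) * (q ^+ j * a j c) by rewrite -lee_fin fineK.
have key := tree_recursion (ltW eps0) (ltW q0) r0 (powR_ge0 _ _) C0 e1 eq1 er1 a0 asum wB' wC.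
move=> j c; set A := C / _ in key *.
have mg2 := measurable_EFin_gap 2 mg.
rewrite integral_rectangle//; last by move=> z; rewrite lee_fin gap_ge0.
(* Return from constants to gaps by (x - y)^2 <= 2 (x - v)^2 + 2 (y - v)^2, hence the factor 4. The
   constants depend on the truncation, whereas the gaps allow a passage to the limit. *)
have in2 : (\int[leb2 R d]_(y in cube c)
    ((2 * vol j)%:E * ((g y - v j c) ^+ 2)%:E + (2 * w j c)%:E) =
    (4 * w j c * vol j)%:E)%E.
  have vol0 : 0 <= vol j by apply: ltW; exact: @vol_gt0.
  rewrite ge0_integralD//; last 3 first.
  - by move=> x _; rewrite mule_ge0// lee_fin mulr_ge0.
  - by apply: measurable_funTS; apply: measurable_funeM.
  - by move=> x _; rewrite lee_fin mulr_ge0 ?fine_ge0.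
  rewrite ge0_integralZl//; last 2 first.
  - exact: measurable_funTS.
  - by rewrite lee_fin mulr_ge0.
  rewrite -/(wE j c) -(fineK (wfin j c)) -/(w j c).
  rewrite integral_cst// [X in (_ + _ * X)%E](leb2_cube c) -!EFinM -EFinD.
  by congr EFin; ring.
apply: (@le_trans _ _ (4 * w j c * vol j)%:E); last first.
  rewrite lee_fin ler_wpM2r//; first by apply: ltW; exact: @vol_gt0.
  by rewrite -[leRHS]mulrA ler_wpM2l//; exact: key.
rewrite -in2; apply: ge0_le_integral_nomeas => y _.
  by apply: integral_ge0 => x _; rewrite lee_fin gap_ge0.
apply: (@le_trans _ _ (\int[leb2 R d]_(x in cube c)
    (2%:E * ((g x - v j c) ^+ 2)%:E + (2 * (g y - v j c) ^+ 2)%:E))%E).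
  apply: ge0_le_integral_nomeas => x _; first by rewrite lee_fin gap_ge0.
  rewrite gap2E -EFinM -EFinD lee_fin /=.
  have := sqr_ge0 ((g x - v j c) + (g y - v j c)); rewrite !expr2; lra.
rewrite ge0_integralD//; last 3 first.
- by move=> x _; rewrite mule_ge0.
- by apply: measurable_funTS; apply: measurable_funeM.
- by move=> x _; rewrite lee_fin mulr_ge0 ?sqr_ge0.
rewrite ge0_integralZl//; last exact: measurable_funTS.
rewrite -/(wE j c) -(fineK (wfin j c)) -/(w j c).
rewrite integral_cst// [X in (_ + _ * X)%E](leb2_cube c) -!EFinM -!EFinD lee_fin.
by rewrite le_eqVlt; apply/orP; left; apply/eqP; ring.
Qed.

End poincare.

Section adaptive.
Context {R : realType} {d : nat}.
Local Notation idx := (@idx d).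
Local Notation cube := (@cube R d).
Local Notation vol := (@vol R d).

(** The constant of [truncated_poincare] does not involve the truncation level, so the truncation
    can be removed. *)
Lemma besov_poincare (p sigma : R) : (0 < d)%N -> 0 < p -> p < 2 -> 0 < sigma ->
  2 * d%:R * (p^-1 - 2^-1) < sigma ->
  exists2 A : R, 0 < A &
  forall (f : Rdd R d -> R) (a : forall j, idx j -> R),
  measurable_fun setT f -> (forall x, 0 <= f x) ->
  (forall j c, 0 <= a j c) ->
  (forall j c, \sum_(c' : idx j.+1 | parent c' == c) a j.+1 c' <= a j c) ->
  (forall j c, (\int[leb4 R d]_(z in cube c `*` cube c) (gap p f z)%:E <=
     ((2 `^ (- (sigma * p))) ^+ j * a j c * vol j)%:E)%E) ->
  forall j c, (\int[leb4 R d]_(z in cube c `*` cube c) (gap 2 f z)%:E <=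
     (A * ((2 `^ (- (2 * sigma - 2 * d%:R * (2 / p - 1)))) ^+ j *
      a j c `^ (2 / p)) * vol j)%:E)%E.
Proof.
move=> d0 p0 p2 s0 sp.
pose b : R := 2 ^+ (2 * d); pose q : R := 2 `^ (- (sigma * p)).
pose e : R := 2 / p; pose xi : R := 2 * sigma - 2 * d%:R * (e - 1).
pose r : R := q `^ e * b `^ (e - 1).
have small x : 0 < x -> 2 `^ (- x) < 1 :> R.
  by apply: powRN_lt1; rewrite ltr1n.
have q0 : 0 < q by exact: powR_gt0.
have q1 : q < 1 by apply: small; rewrite mulr_gt0.
(* This is the lower bound on [sigma]: xi = 2 (sigma - 2d (1/p - 1/2)). *)
have xi0 : 0 < xi.
  have : 4 * d%:R * (p^-1 - 2^-1) = 2 * d%:R * (e - 1).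
    by rewrite /e; field; rewrite gt_eqF.
  by rewrite /xi; lra.
have rE : r = 2 `^ (- xi).
  rewrite /r /q /b exprn_powR// natrM -powRrM -powRD; last first.
    by rewrite pnatr_eq0 implybT.
  by congr (_ `^ _); rewrite /xi /e; field; rewrite gt_eqF.
have r0 : 0 < r by rewrite rE powR_gt0.
have r1 : r < 1 by rewrite rE small.
pose t := Num.max q r.
have qt : q <= t by rewrite le_max lexx.
have rt : r <= t by rewrite le_max lexx orbT.
have t1 : t < 1 by rewrite gt_max q1.
pose eps := (1 - t) / 2.
have eps0 : 0 < eps by rewrite divr_gt0// subr_gt0.
have et : (1 + eps) * t < 1 by rewrite /eps; nra.
have eq1 : (1 + eps) * q < 1 by apply: le_lt_trans et; rewrite ler_wpM2l//; lra.
have er1 : (1 + eps) * r < 1 by apply: le_lt_trans et; rewrite ler_wpM2l//; lra.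
pose C := (1 + eps^-1) * (2 * 2 `^ p * b) `^ e.
have C0 : 0 < C.
  rewrite mulr_gt0 ?powR_gt0 ?addr_gt0 ?invr_gt0//.
  by rewrite !mulr_gt0 ?powR_gt0 ?exprn_gt0.
exists (4 * (C / (1 - (1 + eps) * r))).
  by rewrite mulr_gt0// divr_gt0// subr_gt0.
move=> f a mf f0 a0 asum aE j c; rewrite -/e -/xi -rE.
have mc := @measurable_cube2 R d _ c.
apply: integral_gap2_le => // n.
apply: (truncated_poincare (p := p) (q := q) (b := b) (M := n%:R)) => //.
- exact: ltW.
- by apply: measurable_minr.
- by move=> x; rewrite le_min f0 ler0n /= ge_min lexx orbT.
move=> i c'; apply: le_trans (aE i c').
(* Truncation is 1-Lipschitz, so the truncated function inherits the bound on the p-gap. *)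
apply: ge0_le_integral_nomeas => z _; first by rewrite lee_fin gap_ge0.
rewrite lee_fin /gap; apply: ge0_ler_powR; rewrite ?nnegrE ?(ltW p0)//.
case: (leP (f z.1) n%:R); case: (leP (f z.2) n%:R) => h1 h2 //;
  by rewrite ler_norml; have := ler_norm (f z.1 - f z.2);
     have := ler_norm (- (f z.1 - f z.2)); rewrite normrN; lra.
Qed.

Lemma adaptive_approximation (p sigma : R) : (0 < d)%N -> 0 < p -> p < 2 ->
  0 < sigma -> 2 * d%:R * (p^-1 - 2^-1) < sigma ->
  exists2 C : R, 0 < C &
  forall (f : Rdd R d -> R) (eta S : R), measurable_fun setT f ->
    (forall x, 0 <= f x) -> 0 < eta -> 0 <= S ->
    (besov_seminorm sigma p%:E p f <= S%:E)%E ->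
  approximable sigma C eta S f.
Proof.
move=> d0 p0 p2 s0 sp.
have [A A0 hA] := besov_poincare d0 p0 p2 s0 sp.
have [C3 C30 hC3] := @besov_energy R d p sigma d0 p0 s0.
have d0' : 0 < d%:R :> R by rewrite ltr0n.
pose b : R := 2 ^+ (2 * d); pose e : R := 2 / p.
pose xi : R := 2 * sigma - 2 * d%:R * (e - 1).
pose r : R := 2 `^ (- xi).
have b0 : 0 < b by rewrite exprn_gt0.
have e0 : 0 < e by rewrite divr_gt0.
have xi0 : 0 < xi.
  have : 4 * d%:R * (p^-1 - 2^-1) = 2 * d%:R * (e - 1).
    by rewrite /e; field; rewrite gt_eqF.
  by rewrite /xi; lra.
have r0 : 0 < r by exact: powR_gt0.
(* Chosen so that r^(p/2) = b^(-tau), the rate at which the bound on the number of divided cubes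
   decreases with the level. *)
pose tau := xi * p / (4 * d%:R).
have tau0 : 0 < tau by rewrite divr_gt0 ?mulr_gt0.
have tauE : 1 + tau = p / 2 * ((d%:R + sigma) / d%:R).
  by rewrite /tau /xi /e; field; rewrite !gt_eqF.
have b4 : 4 <= b.
  rewrite /b exprM (_ : 2 ^+ 2 = 4); last by ring.
  by rewrite -[leLHS]expr1 ler_weXn2l// ler1n.
have rb : r `^ (p / 2) = b `^ (- tau).
  rewrite /r /b exprn_powR// natrM -powRrM; congr (_ `^ _).
  by rewrite /tau; field; rewrite gt_eqF.
have [C4 C40 hC4] := sum_min_powR_le b4 tau0.
(* Absorbs the energy constant: [N0E] turns the bound on the number of divided cubes into a power of
   [N0]. *)
pose k3 := C3 `^ (1 + tau)^-1.
have k30 : 0 < k3 by exact: powR_gt0.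
pose C5 := 1 + b * (C4 * (1 + k3)).
have C50 : 0 < C5 by rewrite addr_gt0// !mulr_gt0// addr_gt0.
exists (C5 + A * C5); first by rewrite addr_gt0// mulr_gt0.
move=> f eta S mf f0 eta0 S0 hS.
have [a [a0 asum alev aE]] := hC3 f S mf S0 hS.
have poinc := hA f a mf f0 a0 asum aE.
rewrite -/e -/xi -/r in poinc.
rewrite /approximable; set g := d%:R / (d%:R + sigma); set Nf := _ `^ g.
have Nf0 : 0 <= Nf by exact: powR_ge0.
(* The added 1 keeps [N] positive when S = 0, as division by [N] requires. *)
pose N0 := k3 * Nf; pose N := N0 + 1.
have N00 : 0 <= N0 by rewrite mulr_ge0// ltW.
have N1 : 0 < N by exact: ltr_wpDl.
have tau1 : 0 < 1 + tau by exact: addr_gt0.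
have N0E : N0 `^ (1 + tau) = C3 * (S ^+ 2 / eta) `^ (p / 2).
  rewrite /N0 powRM ?(ltW k30)// /k3 /Nf -!powRrM mulVf ?gt_eqF// powRr1 ?(ltW C30)//.
  congr (_ * _ `^ _); rewrite tauE /g; field.
  by rewrite !gt_eqF// addr_gt0.
have p20 : 0 < p / 2 by rewrite divr_gt0.
pose E j : {pred idx j} := [pred c | eta < r ^+ j * a j c `^ e].
(* Markov's inequality: each cube of [E j] has energy at least (eta / r^j)^(p/2), and the energies
   of a level sum to at most C3 S^p. *)
have Ele j : #|E j|%:R <= N `^ (1 + tau) * (b `^ (- tau)) ^+ j.
  have rj0 : 0 < r ^+ j by rewrite exprn_gt0.
  have er0 : 0 < eta / r ^+ j by rewrite divr_gt0.
  have h1 : #|E j|%:R * (eta / r ^+ j) `^ (p / 2) <= C3 * S `^ p.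
    apply: le_trans (alev j).
    rewrite (bigID (fun c => c \in E j)) /= -[leLHS]addr0 lerD ?sumr_ge0//.
    rewrite mulr_natl -sumr_const; apply: ler_sum => c.
    rewrite inE => hc; have h : eta / r ^+ j <= a j c `^ e.
      by rewrite ler_pdivrMr// mulrC ltW.
    have -> : a j c = (a j c `^ e) `^ (p / 2).
      rewrite -powRrM /e (_ : 2 / p * (p / 2) = 1) ?powRr1//.
      by field; rewrite gt_eqF.
    by apply: ge0_ler_powR; rewrite ?nnegrE ?powR_ge0 ?(ltW p20) ?(ltW er0).
  have pw0 : 0 < (eta / r ^+ j) `^ (p / 2) by exact: powR_gt0.
  have h2 : #|E j|%:R <= C3 * S `^ p / (eta / r ^+ j) `^ (p / 2) by rewrite ler_pdivlMr.
  have h3 : C3 * S `^ p / (eta / r ^+ j) `^ (p / 2) = N0 `^ (1 + tau) * (b `^ (- tau)) ^+ j.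
    rewrite N0E -rb (powRM (p / 2) (sqr_ge0 S)) ?invr_ge0 ?(ltW eta0)//.
    rewrite (powRM (p / 2) (ltW eta0)) ?invr_ge0 ?(ltW rj0)//.
    have -> : (S ^+ 2) `^ (p / 2) = S `^ p.
      by rewrite exprn_powR// mulrCA divff ?mulr1.
    have rjE : (r ^+ j) `^ (p / 2) = (r `^ (p / 2)) ^+ j.
      by rewrite (exprn_powR _ _ (ltW r0)) (powR_exprn _ _ (ltW r0)) mulrC.
    rewrite (invr_powR _ (ltW eta0)) (invr_powR _ (ltW rj0)) !powRN rjE.
    by field; rewrite !gt_eqF ?exprn_gt0 ?powR_gt0.
  apply: (le_trans h2); rewrite h3 ler_wpM2r ?exprn_ge0 ?powR_ge0//.
  by apply: ge0_ler_powR; rewrite ?nnegrE ?(ltW tau1) ?N00 ?(ltW N1)// /N lerDl.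
have Ele2 j : #|E j|%:R <= N * (b ^+ j / N) `^ (- tau).
  apply: le_trans (Ele j) _; rewrite le_eqVlt; apply/orP; left; apply/eqP.
  have bj0 : 0 < b ^+ j by rewrite exprn_gt0.
  rewrite (powRM (- tau) (ltW bj0)) ?invr_ge0 ?(ltW N1)//.
  rewrite (invr_powR _ (ltW N1)) opprK (exprn_powR _ _ (ltW b0)).
  rewrite (powR_exprn _ _ (ltW b0)) (mulrC j%:R).
  rewrite powRD ?powRr1 ?(ltW N1)//; first by ring.
  by rewrite (gt_eqF N1) implybT.
have Ele1 j : #|E j|%:R <= b ^+ j.
  apply: (@le_trans _ _ #|{: idx j}|%:R); first by rewrite ler_nat max_card.
  by rewrite card_idx !natrX /b -!exprM mulnC.
(* The cardinals are integers bounded by a sequence tending to 0, so some level has no cube to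
   divide. Stopping there leaves every piece outside its [E j]. *)
have [J hJ] : exists J, #|E J| = 0%N.
  apply: contrapT => /forallNP hJ.
  have : N `^ (1 + tau) > 0 by exact: powR_gt0.
  suff : (N `^ (1 + tau))^-1 <= 0 by rewrite invr_le0 => /le_lt_trans h /h; rewrite ltxx.
  apply: (@le0_of_geometric _ _ 1 (b `^ (- tau))).
    by rewrite powR_ge0 powRN_lt1// (lt_le_trans _ b4)// ltr1n.
  move=> n; rewrite mulr1 -[leLHS]mulr1 ler_pdivrMl ?powR_gt0//.
  apply: le_trans (Ele n); rewrite ler1n lt0n; apply/eqP; exact: hJ.
have [m [dm cm lm]] := @exists_dyadic_partition R d E J d0.
have cm' : #|` m|%:R <= C5 * (1 + Nf).
  apply: (@le_trans _ _ (1 + (\sum_(j < J) #|E j|%:R) * b)).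
    move: cm; rewrite -(ler_nat R) => /le_trans; apply.
    rewrite natrD natr_sum lerD2l mulr_suml; apply: ler_sum => j _.
    by rewrite natrM natrX.
  have := hC4 N (fun j => #|E j|%:R) J N1 Ele1 Ele2 => h.
  apply: (le_trans (lerD (lexx 1) (ler_wpM2r (ltW b0) h))).
  rewrite -subr_ge0.
  have -> : C5 * (1 + Nf) - (1 + C4 * N * b) =
      Nf + b * C4 * k3 + b * C4 * Nf by rewrite /C5 /N /N0; ring.
  by rewrite !addr_ge0// !mulr_ge0// ltW.
have AB0 (K : set (Rdd R d)) : 0 <= A * eta by rewrite mulr_ge0// ltW.
have [K Km|v v0 hv] := exists_step_values mf f0 AB0 (m := m).
  have [j [c [KE [cE _]]]] := lm K Km; exists j, c; split=> //.
  rewrite KE; apply: le_trans (poinc j c) _; rewrite lee_fin.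
  rewrite ler_wpM2r//; first by apply: ltW; exact: @vol_gt0.
  rewrite ler_wpM2l ?(ltW A0)// leNgt; apply/negP => h.
  have cEj : c \in E j by [].
  by have jJ := cE cEj; subst j; move: hJ => /card0_eq /(_ c); rewrite cEj.
exists m, v; split=> //.
  apply: (le_trans cm'); rewrite ler_wpM2r ?addr_ge0//.
  by rewrite lerDl mulr_ge0// ltW.
apply: (le_trans hv); rewrite lee_fin big_const_seq count_predT iter_addr_0 -[leLHS]mulr_natr.
apply: (le_trans (ler_wpM2l _ cm')); first by rewrite mulr_ge0// ltW.
have -> : (C5 + A * C5) * eta * (1 + Nf) =
    A * eta * (C5 * (1 + Nf)) + C5 * eta * (1 + Nf) by ring.
by rewrite lerDl mulr_ge0 ?addr_ge0// mulr_ge0// ltW.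
Qed.

End adaptive.

(** * From approximation to the risk *)

Section risk.
Context {R : realType} {d : nat}.

Lemma besov_approximation (p sigma : R) : (0 < d)%N -> 0 < p -> 0 < sigma ->
  2 * d%:R * Num.max (p^-1 - 2^-1) 0 < sigma ->
  exists2 C : R, 0 < C &
  forall (f : Rdd R d -> R) (eta S : R), measurable_fun setT f ->
    (forall x, 0 <= f x) -> 0 < eta -> 0 <= S ->
    (besov_seminorm sigma (besov_q p) p f <= S%:E)%E ->
  approximable sigma C eta S f.
Proof.
move=> d0 p0 s0 sp; have [p2|p2] := ltP p 2.
  have -> : besov_q p = p%:E by rewrite /besov_q p2.
  apply: adaptive_approximation => //; apply: le_lt_trans sp.
  by rewrite ler_wpM2l ?mulr_ge0// le_max lexx.
have -> : besov_q p = +oo%E by rewrite /besov_q ltNge p2.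
have [C C0 hC] := @uniform_approximation R d p sigma d0 p2 s0.
exists C => // f eta S mf f0 eta0 S0 hS; apply: hC => // t t0.
have : ((t `^ (- sigma))%:E * modulus p f t <= S%:E)%E.
  apply: le_trans hS; apply: ereal_sup_ubound; exists t => //=.
  by rewrite in_itv/= t0.
by rewrite powRN lee_pdivrMl ?powR_gt0// -EFinM mulrC.
Qed.

Context {disp : measure_display} {Omega : measurableType disp}.
Variable P : probability Omega R.

(** On the unit cube the law of [X] is dominated, as a measure, by kappa times the Lebesgue measure,
    and [h] vanishes elsewhere; the integral is monotone in the measure. *)
Lemma integral_bounded_density (X : {mfun Omega >-> Rd R d}) (phi : Rd R d -> R)
    (kappa : R) (h : Rd R d -> \bar R) : 0 <= kappa ->
  has_density P X phi -> (forall x, unit_cube x -> phi x <= kappa) ->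
  measurable_fun setT h -> (forall x, 0 <= h x)%E ->
  (forall x, ~ unit_cube x -> h x = 0%E) ->
  (\int[P]_w h (X w) <= kappa%:E * \int[lebesgue_Rd R d]_x h x)%E.
Proof.
move=> k0 [mphi phi0 Xphi] phik mh h0 hU.
have mU := @measurable_unit_cube R d.
have restrict (mu : {measure set (Rd R d) -> \bar R}) :
    (\int[mu]_x h x = \int[mu]_(x in unit_cube) h x)%E.
  rewrite [RHS]integral_mkcond; apply: eq_integral => x _; rewrite patchE.
  by case: ifPn => // /negP xU; apply: hU => ?; apply: xU; rewrite inE.
have -> : (\int[P]_w h (X w) = \int[distribution P X]_x h x)%E.
  by rewrite ge0_integral_distribution.
rewrite !restrict.
have -> : (\int[distribution P X]_(x in unit_cube) h x =
    \int[mrestr (distribution P X) mU]_(x in unit_cube) h x)%E.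
  by apply: eq_measure_integral => A mA AU; rewrite /= /mrestr setIidl.
have <- := @ge0_integral_mscale _ _ _ (lebesgue_Rd R d) unit_cube mU
  (NngNum k0) h (measurable_funTS mh) (fun x _ => h0 x).
apply: ge0_le_measure_integral => // A mA.
change (distribution P X (A `&` unit_cube) <= kappa%:E * lebesgue_Rd R d A)%E.
rewrite Xphi; last exact: measurableI.
apply: (@le_trans _ _ (\int[lebesgue_Rd R d]_(x in A `&` unit_cube) kappa%:E)%E).
  by apply: ge0_le_integral_nomeas => x [_ Ux]; rewrite lee_fin// phik.
rewrite integral_cst; last exact: measurableI.
apply: lee_wpmul2l => //; apply: le_measure; rewrite ?inE//; exact: measurableI.
Qed.

Lemma expected_hellinger2_le (n : nat) (X : nat -> {mfun Omega >-> Rd R d})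
    (kappa : R) (f g : Rdd R d -> R) : (0 < n)%N -> 0 <= kappa ->
  (forall i : nat, (i < n)%N ->
       exists2 phi : Rd R d -> R, has_density P (X i) phi &
         forall x, unit_cube x -> phi x <= kappa) ->
  measurable_fun setT f -> measurable_fun setT g ->
  (forall z, ~ unit_cube z.1 -> f z = g z) ->
  (\int[P]_w (hellinger2 n (X^~ w) f g)%:E <=
   (kappa / 2)%:E *
   \int[leb2 R d]_z ((Num.sqrt (f z) - Num.sqrt (g z)) ^+ 2)%:E)%E.
Proof.
move=> n0 k0 hX mf mg fg.
pose G z : \bar R := ((Num.sqrt (f z) - Num.sqrt (g z)) ^+ 2)%:E.
have mG : measurable_fun setT G.
  apply/measurable_EFinP; apply: measurable_funX; apply: measurable_funB;
    exact: measurable_fun_sqrt.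
have G0 z : (0 <= G z)%E by rewrite lee_fin sqr_ge0.
pose h x := (\int[lebesgue_Rd R d]_y G (x, y))%E.
have h0 x : (0 <= h x)%E by apply: integral_ge0.
have mh : measurable_fun setT h.
  exact: (measurable_fun_fubini_tonelli_F (m2 := lebesgue_Rd R d) _ mG).
have hU x : ~ unit_cube x -> h x = 0%E.
  move=> xU; apply: integral0_eq => y _.
  by rewrite /G (fg (x, y))// subrr expr0n.
have n0' : 0 <= (2 * n%:R)^-1 :> R by rewrite invr_ge0 mulr_ge0.
apply: (@le_trans _ _ (\int[P]_w (((2 * n%:R)^-1)%:E * \sum_(i < n) h (X i w)))%E).
  apply: ge0_le_integral_nomeas => w _.
    rewrite lee_fin mulr_ge0// sumr_ge0// => i _; apply: fine_ge0.
    by apply: integral_ge0 => y _; rewrite lee_fin sqr_ge0.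
  rewrite /hellinger2 EFinM; apply: lee_wpmul2l; first by rewrite lee_fin.
  (* The real-valued integral in [hellinger2] is [fine] of the extended one, hence 0 if the latter
     is infinite; for a non-negative x, [fine x] is at most x. *)
  rewrite -sumEFin; apply: lee_sum => i _; rewrite /Rintegral -/(h _).
  have := h0 (X i w); rewrite /h.
  by case: (integral _ _ _) => [r| |] //= _; rewrite leey.
have mhX i : measurable_fun setT (fun w => h (X i w)) by exact: measurableT_comp.
rewrite ge0_integralZl//; last 2 first.
- by apply: emeasurable_sum.
- by move=> w _; apply: sume_ge0.
rewrite ge0_integral_sum//.
apply: (@le_trans _ _ (((2 * n%:R)^-1)%:E *
    \sum_(i < n) (kappa%:E * \int[lebesgue_Rd R d]_x h x))%E).
  apply: lee_wpmul2l; first by rewrite lee_fin.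
  apply: lee_sum => i _; have [phi dphi phik] := hX i (ltn_ord i).
  exact: (integral_bounded_density k0 dphi phik).
rewrite -/G [X in (_ <= _ * X)%E](_ : _ = \int[lebesgue_Rd R d]_x h x)%E; last first.
  by rewrite fubini_tonelli1.
have I0 : (0 <= \int[lebesgue_Rd R d]_x h x)%E by apply: integral_ge0.
have sum_cst (x : \bar R) k : (0 <= x)%E -> (\sum_(i < k) x = k%:R%:E * x)%E.
  move=> x0; elim: k => [|k IH]; first by rewrite big_ord0 mul0e.
  by rewrite big_ord_recr /= IH -natr1 EFinD ge0_muleDl ?lee_fin// mul1e.
rewrite sum_cst ?mule_ge0// !muleA -!EFinM.
rewrite (_ : (2 * n%:R)^-1 * n%:R * kappa = kappa / 2)//.
by field; rewrite pnatr_eq0 -lt0n.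
Qed.

End risk.

(** * From the oracle inequality to the rate of convergence *)

Section corollary.
Context {R : realType}.

Lemma oracle_bound_le (d n : nat) (disp : measure_display)
    (Omega : measurableType disp) (P : probability Omega R)
    (X : nat -> {mfun Omega >-> Rd R d}) (s : Rdd R d -> R)
    (L0 kappa sigma C eta S : R) : (0 < n)%N -> 0 <= kappa -> 0 <= L0 ->
  0 < eta -> eta = ln n%:R / n%:R ->
  markov_chain P X s ->
  (forall i : nat, (i < n)%N ->
       exists2 phi : Rd R d -> R, has_density P (X i) phi &
         forall x, unit_cube x -> phi x <= kappa) ->
  approximable sigma C eta S (fun z => Num.sqrt (s z)) ->
  (oracle_bound P n L0 None X s <=
   ((kappa / 2 + L0) * C * eta *
    (1 + (S ^+ 2 / eta) `^ (d%:R / (d%:R + sigma))))%:E)%E.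
Proof.
move=> n0 k0 L00 eta0 etaE [[ms s0 _] _] hX.
rewrite /approximable; set N := _ `^ _ => -[m [v [[pm mm dm um] v0 cm hv]]].
(* Squares, because [v] approximates the square root of [s] and the loss compares square roots. *)
pose g z := \sum_(K <- m) v K ^+ 2 * \1_K z.
have mg : measurable_fun setT g.
  have mt K : K \in m -> measurable_fun setT (fun z => v K ^+ 2 * \1_K z).
    move=> /mm[mK _]; exact: measurable_funM.
  (* The test [K \in m] makes the summand measurable for every set [K], as [measurable_sum] asks. *)
  rewrite /g; apply: (eq_measurable_fun (fun z =>
    \sum_(K <- m) (if K \in m then v K ^+ 2 * \1_K z else 0))).
    by move=> z _; rewrite big_seq [RHS]big_seq; apply: eq_bigr => K ->.
  apply: measurable_sum => K; case: (boolP (K \in m)) => [Km|_].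
    exact: mt.
  exact: measurable_cst.
have gK K z : K \in m -> K z -> g z = v K ^+ 2.
  move=> Km Kz; rewrite /g (big_fsetD1 K)//= indicE mem_set// mulr1.
  rewrite big_seq big1 ?addr0// => K'; rewrite !inE => /andP[K'K K'm].
  rewrite indicE memNset ?mulr0// => K'z; move/eqP: K'K; apply.
  exact: dm K'm Km K'z Kz.
have gout z : ~ unit_cube2 z -> g z = 0.
  move=> Az; rewrite /g big_seq big1// => K Km.
  by rewrite indicE memNset ?mulr0// => Kz; apply: Az; case: (mm _ Km) => _; apply.
pose f := times_indic s unit_cube2.
have fout z : ~ unit_cube2 z -> f z = 0.
  by move=> Az; rewrite /f /times_indic indicE memNset// mulr0.
have mf : measurable_fun setT f.
  apply: measurable_funM => //; apply: measurable_indic.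
  exact: measurable_unit_cube2.
apply: (@le_trans _ _ ('E_P[fun w => (hellinger_set n (X^~ w) f (step_functions m) ^+ 2)%R]
   + (penalty n L0 m)%:E)%E).
  by apply: ereal_inf_lbound; exists m.
have gstep : step_functions m g.
  by exists (fun K => v K ^+ 2) => // K; rewrite sqr_ge0.
have h2 w : 0 <= hellinger2 n (X^~ w) f g.
  rewrite mulr_ge0 ?invr_ge0 ?mulr_ge0// sumr_ge0// => i _; apply: fine_ge0.
  by apply: integral_ge0 => y _; rewrite lee_fin sqr_ge0.
have hle w : hellinger_set n (X^~ w) f (step_functions m) ^+ 2 <=
    hellinger2 n (X^~ w) f g.
  have lb : lbound [set hellinger n (X^~ w) f u | u in step_functions m] 0.
    by move=> _ [u _ <-]; exact: sqrtr_ge0.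
  have i0 : 0 <= hellinger_set n (X^~ w) f (step_functions m).
    by apply: lb_le_inf => //; exists (hellinger n (X^~ w) f g); exists g.
  rewrite -[leRHS](sqr_sqrtr (h2 w)) lerXn2r ?nnegrE ?sqrtr_ge0//.
  by apply: ge_inf; [exists 0|exists g].
have int_le : (\int[leb2 R d]_z ((Num.sqrt (f z) - Num.sqrt (g z)) ^+ 2)%:E <=
    (C * eta * (1 + N))%:E)%E.
  apply: le_trans hv.
  pose G z : \bar R := ((Num.sqrt (f z) - Num.sqrt (g z)) ^+ 2)%:E.
  have mG : measurable_fun setT G.
    by apply/measurable_EFinP; apply: measurable_funX; apply: measurable_funB;
      exact: measurable_fun_sqrt.
  have G0 z : (0 <= G z)%E by rewrite lee_fin sqr_ge0.
  rewrite -/(G _) (_ : (\int[_]_z _)%E = (\int[leb2 R d]_(z in unit_cube2) G z)%E); last first.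
    rewrite [RHS]integral_mkcond; apply: eq_integral => z _; rewrite patchE.
    case: ifPn => // /negP zA.
    have Az : ~ unit_cube2 z by move=> ?; apply: zA; rewrite inE.
    by rewrite /G fout// gout// subrr expr0n.
  apply: le_trans (@integral_le_sum_cover _ _ _ (leb2 R d) _ m (fun K => K) unit_cube2 G
     measurable_unit_cube2 mG G0 _ um) _.
    by move=> K /mm[].
  rewrite big_seq [leRHS]big_seq; apply: lee_sum => K Km.
  rewrite le_eqVlt; apply/orP; left; apply/eqP; apply: eq_integral => z.
  rewrite inE => Kz; rewrite /G (gK K z)// sqrtr_sqr ger0_norm//.
  rewrite /f /times_indic indicE mem_set ?mulr1//.
  by case: (mm _ Km) => _; apply.
(* The first summand bounds the approximation error, where kappa/2 combines the density bound with
   the 1/2 of the loss; the second bounds the penalty. *)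
rewrite -[X in (_ <= X%:E)%E](_ : kappa / 2 * (C * eta * (1 + N)) +
   L0 * (C * (1 + N)) * eta = _); last by ring.
rewrite EFinD; apply: leeD.
  rewrite unlock.
  apply: (@le_trans _ _ (\int[P]_w (hellinger2 n (X^~ w) f g)%:E)%E).
    by apply: ge0_le_integral_nomeas => w _; rewrite lee_fin ?sqr_ge0.
  apply: (@le_trans _ _ ((kappa / 2)%:E *
     \int[leb2 R d]_z ((Num.sqrt (f z) - Num.sqrt (g z)) ^+ 2)%:E)%E).
    apply: expected_hellinger2_le => // z Uz.
    have Az : ~ unit_cube2 z by case.
    by rewrite fout// gout.
  rewrite [leRHS]EFinM; apply: lee_wpmul2l => //; rewrite lee_fin divr_ge0//.
rewrite lee_fin /penalty -[leLHS]mulrA -etaE ler_wpM2r ?(ltW eta0)//.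
by rewrite ler_wpM2l.
Qed.

End corollary.

Lemma besov_seminorm_ge0 (R : realType) (d : nat) (sigma : R) (q : \bar R) (p : R)
  (f : Rdd R d -> R) : (0 <= besov_seminorm sigma q p f)%E.
Proof.
have sup0 : (0 <= ereal_sup [set ((t `^ (- sigma))%:E * modulus p f t)%E
                 | t in `]0%R, +oo[%classic])%E.
  apply: (@le_trans _ _ ((1 `^ (- sigma))%:E * modulus p f 1)%E).
    by rewrite mule_ge0 ?lee_fin ?powR_ge0// modulus_ge0.
  by apply: ereal_sup_ubound; exists 1 => //=; rewrite in_itv/= ltr01.
by case: q => [q| |] //=; exact: poweR_ge0.
Qed.

Theorem corollary2 (R : realType) (L0 : R) (L0P : oracle_constant L0)
    (d : nat) (d_ge1 : (1 <= d)%N) (kappa : R) (kappa_gt0 : 0 < kappa)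
    (p : R) (p_gt : 2 * d%:R / (d%:R + 1) < p)
    (sigma : R) (sigma_gt : 2 * d%:R * Num.max (p^-1 - 2^-1) 0 < sigma)
    (sigma_lt1 : sigma < 1) :
  exists2 C' : R, 0 < C' &
  forall (n : nat), (3 < n)%N ->
  forall (disp : measure_display) (Omega : measurableType disp)
    (P : probability Omega R) (X : nat -> {mfun Omega >-> Rd R d})
    (s : Rdd R d -> R),
    markov_chain P X s ->
    (forall i : nat, (i < n)%N ->
       exists2 phi : Rd R d -> R, has_density P (X i) phi &
         forall x, unit_cube x -> phi x <= kappa) ->
    in_besov sigma (besov_q p) p (fun z => Num.sqrt (s z)) ->
  forall mhat : Omega -> {fset set (Rdd R d)},
    selected n L0 None X mhat ->
    (C'%:E * risk P n X s mhat <=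
     besov_seminorm sigma (besov_q p) p (fun z => Num.sqrt (s z))
       `^ (2 * d%:R / (d%:R + sigma)) *
     ((ln n%:R / n%:R) `^ (sigma / (sigma + d%:R)))%:E +
     (ln n%:R / n%:R)%:E)%E.
Proof.
have [L00 [C0 C00 oracle]] := L0P.
have d0 : 0 < d%:R :> R by rewrite ltr0n.
have p0 : 0 < p by apply: le_lt_trans p_gt; rewrite divr_ge0// ?mulr_ge0 ?addr_ge0.
have s0 : 0 < sigma.
  by apply: le_lt_trans sigma_gt; rewrite !mulr_ge0// le_max lexx orbT.
have [C Cgt0 approx] := besov_approximation d_ge1 p0 s0 sigma_gt.
pose C1 := (kappa / 2 + L0) * C.
have C10 : 0 < C1 by rewrite mulr_gt0// addr_gt0// divr_gt0.
(* [C1] is the factor of eta (1 + N) in [oracle_bound_le], and [C0] that of the risk in the oracle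
   inequality. *)
exists (C0 / C1); first exact: divr_gt0.
move=> n n3 disp Omega P X s chain hX [_ _ semi_fin] mhat sel.
set semi := besov_seminorm _ _ _ _ in semi_fin *.
have semi0 : (0 <= semi)%E by exact: besov_seminorm_ge0.
pose S := fine semi; have S0 : 0 <= S by exact: fine_ge0.
have semiE : semi = S%:E by rewrite fineK// ge0_fin_numE.
pose eta : R := ln n%:R / n%:R.
have n0' : (0 < n)%N by exact: leq_trans n3.
have n0 : 0 < n%:R :> R by rewrite ltr0n.
have eta0 : 0 < eta by rewrite divr_gt0// ln_gt0// ltr1n (leq_trans _ n3).
have msqrt : measurable_fun setT (fun z => Num.sqrt (s z)).
  by case: chain => -[ms _ _] _; exact: measurable_fun_sqrt.
have app : approximable sigma C eta S (fun z => Num.sqrt (s z)).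
  by apply: (approx _ _ _ msqrt (fun z => sqrtr_ge0 _) eta0 S0); rewrite -semiE.
have bound := oracle_bound_le n0' (ltW kappa_gt0) (ltW L00) eta0 erefl chain hX app.
have l_neq0 : None <> Some 0%N by [].
have := oracle d n d_ge1 n3 disp Omega P X s chain L0 None (lexx _) l_neq0 mhat sel.
move=> /le_trans/(_ bound); set N := _ `^ _ => risk_le.
rewrite semiE poweR_EFin -EFinM -EFinD mulrC EFinM -muleA lee_pdivrMl//.
apply: le_trans risk_le _; rewrite -EFinM lee_fin -/eta -mulrA ler_wpM2l ?(ltW C10)//.
(* Expand eta (1 + N): the term eta is log n / n, and eta N is S^(2d/(d + sigma)) eta^(1 - d/(d +
   sigma)). *)
rewrite mulrDr mulr1 addrC lerD2r /N powRM ?sqr_ge0 ?invr_ge0 ?(ltW eta0)//.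
rewrite (exprn_powR _ _ S0) (invr_powR _ (ltW eta0)).
have -> : 2%:R * (d%:R / (d%:R + sigma)) = 2 * d%:R / (d%:R + sigma) :> R.
  by rewrite mulrA.
rewrite mulrCA ler_wpM2l ?powR_ge0//.
rewrite -[X in X * _ <= _](powRr1 (ltW eta0)) -powRD; last by rewrite (gt_eqF eta0) implybT.
rewrite le_eqVlt; apply/orP; left; apply/eqP; congr (_ `^ _).
field; rewrite gt_eqF// addr_gt0//.
Qed.
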